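(* Let $n\ge 1$, let $\mathcal{Q}$ be the set of all real $n\times n$ orthogonal matrices, let $\mathcal{R}^+$ be the set of all real $n\times n$ upper triangular matrices with positive diagonal entries, and let $\overline{\mathcal{R}}^+$ be the closure of $\mathcal{R}^+$ in $\mathfrak{gl}(n,\mathbb{R})$. Let $F:\mathcal{Q}\times\overline{\mathcal{R}}^+\to\mathfrak{gl}(n,\mathbb{R})$ be the map $F(Q,R)=QR$. Then: (1) The map $F$ is proper, i.e. the inverse image under $F$ of every compact set is compact. (2) The restriction of $F$ to $\mathcal{Q}\times\mathcal{R}^+$ is an analytic diffeomorphism onto its image, and this image is $F(\mathcal{Q}\times\mathcal{R}^+)=\mathrm{GL}(n,\mathbb{R})$. (3) Every real $n\times n$ matrix $A$ can be written as a product $A=QR$ of an orthogonal matrix $Q$ and an upper triangular matrix $R$. This decomposition is unique if $A$ is invertible and all the diagonal entries of the upper triangular matrix $R$ are required to be positive.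
   Context: $\mathfrak{gl}(n,\mathbb{R})$ denotes the space of all real $n\times n$ matrices (with its usual topology as a finite-dimensional real vector space) and $\mathrm{GL}(n,\mathbb{R})$ the open subset of invertible ones. $\mathcal{Q}$ is regarded as an analytic embedded submanifold of $\mathfrak{gl}(n,\mathbb{R})$, and $\mathcal{R}^+$ as an open subset of the vector space of real upper triangular $n\times n$ matrices. An analytic diffeomorphism is a bijection between real-analytic manifolds that is real-analytic with real-analytic inverse. *)

(* Defs.v *)
From HB Require Import structures.
From mathcomp Require Import all_boot all_order all_algebra.
From mathcomp Require Import all_classical all_reals all_analysis.

Set Implicit Arguments.
Unset Strict Implicit.
Unset Printing Implicit Defensive.

Import Order.TTheory GRing.Theory Num.Theory numFieldNormedType.Exports.

Local Open Scope classical_set_scope.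
Local Open Scope ring_scope.

(* All norms on a finite-dimensional real space are equivalent, so the norm
   serves only to carry the usual topology. *)
#[short(type="normedVectType")]
HB.structure Definition NormedVect (R : realType) :=
  {V of NormedModule R V & Vector R V}.

Set Warnings "-redundant-canonical-projection".
HB.instance Definition _ (R : realType) (m n : nat) :=
  NormedModule.on 'M[R]_(m, n).
HB.instance Definition _ (R : realType) (V W : normedVectType R) :=
  NormedModule.on (V * W)%type.
Set Warnings "redundant-canonical-projection".

Section Analytic.
Context (R : realType) (V : normedVectType R) (W : normedModType R).

Local Notation N := (\dim {:V}).
Local Notation coordinate i h := (coord (vbasis {:V}) i h).

(* Degree k part of the power series with coefficients c in the coordinates of
   h. An exponent in a multi-index of total degree k is at most k, hence the
   finite range 'I_k.+1. *)
Definition homog_part (c : {ffun 'I_N -> nat} -> W) (h : V) (k : nat) : W :=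
  \sum_(a : {ffun 'I_N -> 'I_k.+1} | (\sum_i a i)%N == k)
    (\prod_i coordinate i h ^+ a i) *: c [ffun i => a i : nat].

Definition homog_abs (c : {ffun 'I_N -> nat} -> W) (h : V) (k : nat) : R :=
  \sum_(a : {ffun 'I_N -> 'I_k.+1} | (\sum_i a i)%N == k)
    (\prod_i `|coordinate i h| ^+ a i) * `|c [ffun i => a i : nat]|.

(* Near x, f is the sum of an absolutely convergent power series in x' - x;
   grouping the terms by degree is harmless by absolute convergence. *)
Definition analytic_at (f : V -> W) (x : V) : Prop :=
  exists c : {ffun 'I_N -> nat} -> W, \forall h \near (0 : V),
    cvgn (series (homog_abs c h)) /\
    series (homog_part c h) @ \oo --> f (x + h).

End Analytic.

(* An analytic slice chart of M, d-dimensional, in the ambient space V: an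
   analytic diffeomorphism of an open set onto an open set of
   R^d x R^chart_codim that straightens M to R^d x {0}. The functions chart_map
   and chart_inv are total, but matter only on chart_dom and on its image. *)
Record slice_chart (R : realType) (V : normedVectType R) (d : nat)
    (M : set V) := SliceChart {
  chart_codim : nat ;
  chart_dom : set V ;
  chart_map : V -> 'rV[R]_d * 'rV[R]_chart_codim ;
  chart_inv : 'rV[R]_d * 'rV[R]_chart_codim -> V ;
  chart_dom_open : open chart_dom ;
  chart_img_open : open (chart_map @` chart_dom) ;
  chart_map_analytic : forall x, chart_dom x -> analytic_at chart_map x ;
  chart_inv_analytic :
    forall y, (chart_map @` chart_dom) y -> analytic_at chart_inv y ;
  chart_mapK : forall x, chart_dom x -> chart_inv (chart_map x) = x ;
  chart_slice : chart_map @` (M `&` chart_dom) =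
                chart_map @` chart_dom `&` [set y | y.2 = 0] }.

Arguments chart_map {R V d M} s _.
Arguments chart_inv {R V d M} s _.

Definition analytic_submanifold (R : realType) (V : normedVectType R) (d : nat)
    (M : set V) : Prop :=
  forall p, M p -> exists u : slice_chart d M, chart_dom u p.

(* The intrinsic notion for submanifolds: only the values of f on M matter, and
   analyticity is that of the local expressions of f in charts of M and N. *)
Definition analytic_map (R : realType) (V W : normedVectType R) (d e : nat)
    (M : set V) (N : set W) (f : V -> W) : Prop :=
  (forall p, M p -> N (f p)) /\
  forall p, M p ->
    exists (u : slice_chart d M) (v : slice_chart e N),
      [/\ chart_dom u p,
          f @` (M `&` chart_dom u) `<=` chart_dom v &
          forall y : 'rV[R]_d, (chart_map u @` chart_dom u) (y, 0) ->
            analytic_at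
              (fun z : 'rV[R]_d => (chart_map v (f (chart_inv u (z, 0)))).1) y].

Definition analytic_diffeo (R : realType) (V W : normedVectType R)
    (M : set V) (N : set W) (f : V -> W) : Prop :=
  exists d e : nat,
    [/\ analytic_submanifold d M, analytic_submanifold e N, set_bij M N f,
        analytic_map d e M N f &
        exists g : W -> V,
          (forall p, M p -> g (f p) = p) /\ analytic_map e d N M g].

(* Compactness of a subset of D is the same in D and in T. *)
Definition proper_on (T U : topologicalType) (D : set T) (f : T -> U) : Prop :=
  forall K : set U, compact K -> compact (D `&` f @^-1` K).

Section Matrices.
Context (R : realType) (n : nat).

Definition orthogonal_mxs : set 'M[R]_n :=
  [set Q | Q^T *m Q = 1%:M /\ Q *m Q^T = 1%:M].

Definition upper_trig_mxs : set 'M[R]_n :=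
  [set A | forall i j : 'I_n, (j < i)%N -> A i j = 0].

Definition pos_upper_trig_mxs : set 'M[R]_n :=
  upper_trig_mxs `&` [set A | forall i : 'I_n, 0 < A i i].

Definition GL_mxs : set 'M[R]_n := [set A | A \in unitmx].

Definition qr_map (p : 'M[R]_n * 'M[R]_n) : 'M[R]_n := p.1 *m p.2.

End Matrices.

Arguments orthogonal_mxs : clear implicits.
Arguments upper_trig_mxs : clear implicits.
Arguments pos_upper_trig_mxs : clear implicits.
Arguments GL_mxs : clear implicits.
Arguments qr_map : clear implicits.

(* Main.v *)
From HB Require Import structures.
Require Import Defs.
From mathcomp Require Import all_boot all_order all_algebra.
From mathcomp Require Import all_classical all_reals all_analysis.
From mathcomp Require Import perm ring lra.
Import Order.TTheory GRing.Theory Num.Theory.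
Import numFieldNormedType.Exports.
Local Open Scope classical_set_scope.
Local Open Scope ring_scope.

Set Implicit Arguments.
Unset Strict Implicit.
Unset Printing Implicit Defensive.

(* The Gram-Schmidt process gives maps A |-> Q(A), A |-> R(A) = Q(A)^T A on
   GL(n) whose entries are built from those of A by ring operations, inverses
   of nonzero quantities and square roots of positive ones, hence analytic.
   They straighten O(n) x R^+ globally: on the open set of pairs (X, Y) with X
   invertible and Y of positive diagonal,
     (X, Y) |-> (Q(X) up(Y), R(X) - I + low(Y))
   is an analytic diffeomorphism onto an open set, and it maps O(n) x R^+ to
   the slice where the second component vanishes. In this chart
   (Q, R) |-> Q R is the identity of GL(n), and so is its inverse.

   For inverses and square roots, v = a u + b u v + c v^2 is solved as a formal
   power series without constant term: the same recursion with all coefficients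
   replaced by bounds on their absolute values stays summable. The choice
   a = b = 1, c = 0 gives 1 / (1 - u) = 1 + v, and a = c = 1/2, b = 0 gives
   sqrt(1 - u) = 1 - v. *)

(** * Power series in one variable *)

(** Uniqueness of the decomposition is what makes the straightening invertible, and straightening
    O(n) and R^+ together spares a separate chart of O(n). The obstacle is analyticity of inverses
    and square roots in several variables. No composition of power series is used: both functions
    solve a quadratic equation whose solution is determined degree by degree, and a bound on its
    majorant series at a single positive radius already makes the coefficients geometric. Every
    expansion carries such a geometric bound along, so that sums and products need no Cauchy
    estimates. Two claims do not go through the chart. Properness rests on the compactness of O(n).
    Existence for singular matrices is out of reach of Gram-Schmidt, which divides by the norm of a
    column that may vanish; Householder reflections divide only by the squared length of a nonzero
    difference of vectors. *)

Section PowerSeries.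
Context (R : realType).
Implicit Types (u v : nat -> R) (a b c : R).

Definition conv u v (k : nat) : R := \sum_(i < k.+1) u i * v (k - i)%N.

(** Both sides run over the triangle of pairs [(i, j)] with [i + j < n], by diagonals on the left
    and by rows on the right. *)
Lemma sum_conv u v n :
  \sum_(0 <= k < n) conv u v k =
  \sum_(0 <= i < n) u i * \sum_(0 <= j < n - i) v j.
Proof.
elim: n => [|n IH]; first by rewrite !big_geq.
rewrite big_nat_recr //= IH big_nat_recr //= subSnn big_nat1.
rewrite /conv big_ord_recr /= subnn addrA; congr (_ + _).
rewrite -(big_mkord xpredT (fun i => u i * v (n - i)%N)) -big_split /=.
apply: eq_big_nat => i /andP[_ ltin].
by rewrite subSn ?(ltnW ltin)// big_nat_recr //= mulrDr.
Qed.

Lemma sum_geo4_le n m : \sum_(m <= k < n) (4^-1 : R) ^+ k <= 2 * 4^-1 ^+ m.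
Proof.
have [lemn|/ltnW ltnm] := leqP m n; last first.
  by rewrite big_geq // mulr_ge0 // exprn_ge0 // invr_ge0.
rewrite -(subnK lemn); set d := (n - m)%N.
have -> : \sum_(m <= k < d + m) (4^-1 : R) ^+ k =
          (4 / 3) * (4^-1 ^+ m - 4^-1 ^+ (d + m)).
  elim: d => [|d IH]; first by rewrite big_geq // subrr mulr0.
  by rewrite addSn big_nat_recr ?leq_addl //= IH exprS; field.
have : 0 <= (4^-1 : R) ^+ m by rewrite exprn_ge0 // invr_ge0.
have : 0 <= (4^-1 : R) ^+ (d + m) by rewrite exprn_ge0 // invr_ge0.
by lra.
Qed.

(** The product of the partial sums differs from the partial sum of [conv u v] by the pairs with
    [i, j < n <= i + j]. Each of the [n] rows of such pairs contributes at most
    [2 * C ^+ 2 * 4^-1 ^+ n]. *)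
Lemma cauchy_product u v C a b :
    (forall k, `|u k| <= C * 4^-1 ^+ k) -> (forall k, `|v k| <= C * 4^-1 ^+ k) ->
    series u @ \oo --> a -> series v @ \oo --> b ->
  series (conv u v) @ \oo --> a * b.
Proof.
move=> ub vb ua vb'.
have C0 : 0 <= C by have := ub 0%N; rewrite expr0 mulr1; apply: le_trans.
have uv : (series u \* series v) @ \oo --> a * b by exact: cvgM.
suff d0 : (series u \* series v - series (conv u v)) @ \oo --> (0 : R).
  have -> : series (conv u v) =
      (series u \* series v - (series u \* series v - series (conv u v))).
    by apply/funext => n; rewrite !fctE /= opprB addrC subrK.
  by rewrite -[a * b]subr0; apply: cvgB.
apply/cvgr0Pnorm_le => e e0.
have g0 : geometric (2 * C ^+ 2) (2^-1 : R) @ \oo --> (0 : R).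
  by apply: cvg_geometric; rewrite gtr0_norm ?invf_lt1 ?ltr1n ?invr_gt0.
move/cvgr0Pnorm_le : g0 => /(_ e e0); apply: filterS => n; apply: le_trans.
rewrite !fctE /series /= sum_conv big_distrl /=.
rewrite -sumrB.
have -> : \sum_(0 <= i < n) (u i * (\sum_(0 <= j < n) v j) -
    u i * \sum_(0 <= j < n - i) v j) =
    \sum_(0 <= i < n) u i * \sum_(n - i <= j < n) v j.
  apply: eq_big_nat => i /andP[_ lin]; rewrite -mulrBr; congr (_ * _).
  by rewrite (@big_cat_nat _ _ _ (n - i)%N) ?leq_subr //= addrAC subrr add0r.
apply: (le_trans (ler_norm_sum _ _ _)).
apply: (@le_trans _ _ (\sum_(0 <= i < n) 2 * C ^+ 2 * 4^-1 ^+ n)).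
  apply: ler_sum_nat => i /andP[_ lin]; rewrite normrM.
  have -> : 2 * C ^+ 2 * 4^-1 ^+ n = (C * 4^-1 ^+ i) * (C * (2 * 4^-1 ^+ (n - i))) :> R.
    by rewrite -{1}(subnKC (ltnW lin)) exprD; ring.
  apply: ler_pM => //; apply: (le_trans (ler_norm_sum _ _ _)).
  apply: (@le_trans _ _ (\sum_(n - i <= j < n) C * 4^-1 ^+ j)); first exact: ler_sum.
  by rewrite -mulr_sumr ler_wpM2l // sum_geo4_le.
rewrite sumr_const_nat subn0 ger0_norm /geometric /=; last first.
  by rewrite !mulr_ge0 // exprn_ge0 // invr_ge0.
rewrite -[leLHS]mulr_natr -[leLHS]mulrA ler_wpM2l ?mulr_ge0 ?exprn_ge0 //.
(* One factor [2^-1 ^+ n] absorbs the number [n] of rows, since [n < 2 ^ n]; the other one tends to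
   0. *)
have -> : (4^-1 : R) = 2^-1 * 2^-1 by field.
rewrite exprMn -[leLHS]mulrA ler_piMr ?exprn_ge0 ?invr_ge0 //.
rewrite exprVn mulrC ler_pdivrMr ?exprn_gt0 // mul1r -natrX ler_nat.
exact/ltnW/ltn_expl.
Qed.

(* Coefficients of v = a u + b u v + c v^2. When u 0 = v 0 = 0 the omitted terms
   i = 0 and i = k vanish, and omitting them leaves only v j with j < k. *)
Definition riccati_step a b c u v (k : nat) : R :=
  a * u k + \sum_(i < k.+1 | (0 < i < k)%N) (b * u i + c * v i) * v (k - i)%N.

(** Course-of-values recursion encoded by iteration: a step at [k] reads only entries below [k], so
    entry [k] has its final value after [k.+1] steps, whatever the starting sequence. *)
Definition riccati a b c u (k : nat) : R :=
  iter k.+1 (riccati_step a b c u) (fun=> 0) k.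

Lemma eq_riccati_step a b c u v v' k : (forall j, (j < k)%N -> v j = v' j) ->
  riccati_step a b c u v k = riccati_step a b c u v' k.
Proof.
move=> vv'; congr (_ + _); apply: eq_bigr => i /andP[i0 ik].
by rewrite !vv' // ltn_subrL i0 (leq_ltn_trans _ ik).
Qed.

Lemma riccatiE a b c u k :
  riccati a b c u k = riccati_step a b c u (riccati a b c u) k.
Proof.
have stab n j : (j < n)%N -> iter n.+1 (riccati_step a b c u) (fun=> 0) j =
    iter n (riccati_step a b c u) (fun=> 0) j.
  elim: n j => // n IH j jn; rewrite iterS [in RHS]iterS.
  by apply: eq_riccati_step => i ij; apply: IH; exact: leq_trans ij _.
have iterE n j : (j < n)%N -> iter n (riccati_step a b c u) (fun=> 0) j = riccati a b c u j.
  move=> jn; rewrite -(subnK jn); elim: (n - _)%N => // d IH.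
  by rewrite addSn stab // ltn_addl.
by rewrite /riccati iterS; apply: eq_riccati_step => j jk; apply: iterE.
Qed.

Lemma riccati0 a b c u : u 0 = 0 -> riccati a b c u 0 = 0.
Proof.
by move=> u0; rewrite riccatiE /riccati_step u0 mulr0 add0r big1 // => i /andP[i0]; rewrite ltn0.
Qed.

Lemma riccati_conv a b c u k : u 0 = 0 -> let v := riccati a b c u in
  v k = a * u k + (b * conv u v k + c * conv v v k).
Proof.
move=> u0 v; rewrite {1}/v riccatiE -/v; congr (_ + _).
have v0 : v 0 = 0 by exact: riccati0.
rewrite /conv !mulr_sumr -big_split /= [RHS](bigID (fun i : 'I_k.+1 => 0 < i < k)%N) /=.
rewrite [X in _ = _ + X]big1 ?addr0 => [|i].
  by apply: eq_bigr => i _; ring.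
rewrite negb_and -leqNgt leqn0 => /orP[/eqP -> |]; first by rewrite u0 v0; ring.
by rewrite -leqNgt => ki; rewrite (eqP (ki : (k - i == 0)%N)) v0; ring.
Qed.

Lemma riccati_ge0 a b c u k : 0 <= a -> 0 <= b -> 0 <= c ->
  (forall j, 0 <= u j) -> 0 <= riccati a b c u k.
Proof.
move=> a0 b0 c0 u0; elim/ltn_ind: k => k IH; rewrite riccatiE /riccati_step.
rewrite addr_ge0 ?mulr_ge0 // sumr_ge0 // => i /andP[i0 ik].
apply: mulr_ge0; last by rewrite IH // ltn_subrL i0 (leq_ltn_trans _ ik).
by rewrite addr_ge0 ?mulr_ge0 ?IH.
Qed.

(** With partial sums U and V of [u] and of the solution at radius [rho], the equation gives V(n+1)
    <= U(n+1) + (U(n) + V(n)) V(n). The bound 1/4 reproduces itself, because 1/8 + (1/8 + 1/4) / 4 =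
    7/32 <= 1/4. *)
Lemma riccati_sum_le u rho n : 0 <= rho -> u 0 = 0 -> (forall j, 0 <= u j) ->
    (forall m, \sum_(0 <= k < m) u k * rho ^+ k <= 8^-1) ->
  \sum_(0 <= k < n) riccati 1 1 1 u k * rho ^+ k <= 4^-1.
Proof.
move=> r0 u0 uge0 ule; set v := riccati 1 1 1 u.
have vge0 k : 0 <= v k by apply: riccati_ge0.
have v0 : v 0 = 0 by exact: riccati0.
elim: n => [|n IH]; first by rewrite big_geq // invr_ge0.
pose x i := (u i + v i) * rho ^+ i; pose y i := v i * rho ^+ i.
have yge0 i : 0 <= y i by rewrite /y mulr_ge0 // exprn_ge0.
have xge0 i : 0 <= x i by rewrite /x mulr_ge0 ?exprn_ge0 // addr_ge0.
have -> : \sum_(0 <= k < n.+1) v k * rho ^+ k =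
    \sum_(0 <= k < n.+1) u k * rho ^+ k + \sum_(0 <= k < n.+1) conv x y k.
  rewrite -big_split /=; apply: eq_bigr => k _.
  rewrite {1}/v riccati_conv // !mul1r -/v mulrDl; congr (_ + _).
  rewrite /conv -big_split /= big_distrl /=; apply: eq_bigr => i _.
  have -> : rho ^+ k = rho ^+ i * rho ^+ (k - i).
    by rewrite -exprD subnKC // -ltnS.
  by rewrite /x /y; ring.
rewrite sum_conv [X in _ + X]big_nat_recr //= subSnn big_nat1 /y v0 mul0r mulr0 addr0 -/y.
(* The absence of constant terms closes the induction: row [i = 0] vanishes with [x 0], and a row
   [i >= 1] involves only [j < n], for which the bound is already known. *)
have : \sum_(0 <= i < n) x i * \sum_(0 <= j < n.+1 - i) y j <=
       \sum_(0 <= i < n) x i * \sum_(0 <= j < n) y j.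
  apply: ler_sum_nat => -[_|i /andP[_ lin]].
    by rewrite /x u0 v0 addr0 !mul0r.
  rewrite ler_wpM2l // [leRHS](@big_cat_nat _ _ _ (n - i)%N) ?leq_subr //= subSS.
  by rewrite lerDl sumr_ge0.
rewrite -mulr_suml.
have : \sum_(0 <= i < n) x i <= 8^-1 + 4^-1.
  by rewrite /x; under eq_bigr do rewrite mulrDl; rewrite big_split lerD.
have : 0 <= \sum_(0 <= i < n) x i by exact: sumr_ge0.
have : 0 <= \sum_(0 <= i < n) y i by exact: sumr_ge0.
move: IH (ule n.+1); rewrite -/y.
set S := \sum_(0 <= i < n) y i; set T := \sum_(0 <= i < n) x i.
set U := \sum_(_ <= _ < _) _; set W := \sum_(_ <= _ < _) (x _ * _).
by move=> S4 U8 S0 T0 T38 WTS; nra.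
Qed.

End PowerSeries.

(** * Homogeneous polynomials with a bound on their coefficients *)

Section HomogeneousPolynomials.
Context (R : realType) (V : normedVectType R).
Local Notation N := (\dim {:V}).
Local Notation coordinate i h := (coord (vbasis {:V}) i h).
Implicit Types (p q : V -> R) (m : R) (k : nat).

Definition monom (b : {ffun 'I_N -> nat}) (h : V) : R :=
  \prod_i coordinate i h ^+ b i.

(* The bound m is on the sum of the absolute values of the coefficients, which is
   submultiplicative. *)
Definition hpoly k m p := exists s : seq (R * {ffun 'I_N -> nat}),
  [/\ forall t : R * {ffun 'I_N -> nat}, t \in s -> (\sum_i t.2 i)%N = k,
      forall h, p h = \sum_(t <- s) t.1 * monom t.2 h &
      \sum_(t <- s) `|t.1| <= m].

Lemma hpoly_le k m m' p : m <= m' -> hpoly k m p -> hpoly k m' p.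
Proof. by move=> mm' [s [sk ps sm]]; exists s; split=> //; apply: le_trans mm'. Qed.

Lemma hpoly_ge0 k m p : hpoly k m p -> 0 <= m.
Proof. by move=> [s [_ _]]; apply: le_trans; apply: sumr_ge0. Qed.

Lemma hpoly0 k : hpoly k 0 (fun=> 0).
Proof. by exists [::]; split=> // [h|]; rewrite big_nil. Qed.

Lemma hpoly_cst c : hpoly 0 `|c| (fun=> c).
Proof.
exists [:: (c, [ffun=> 0%N])]; split=> [t|h|]; rewrite ?inE ?big_seq1 //=.
  by move=> /eqP -> /=; apply: big1 => i _; rewrite ffunE.
by rewrite /monom big1 ?mulr1 // => i _; rewrite ffunE expr0.
Qed.

Lemma hpoly_coord i : hpoly 1 1 (fun h => coordinate i h).
Proof.
exists [:: (1, [ffun j => (j == i) : nat])]; split=> [t|h|]; rewrite ?inE ?big_seq1 ?normr1 //=.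
  move=> /eqP -> /=; rewrite (bigD1 i) //= big1 ?ffunE ?eqxx ?addn0 // => j ji.
  by rewrite ffunE (negbTE ji).
rewrite mul1r /monom (bigD1 i) //= big1 ?ffunE ?eqxx ?mulr1 ?expr1 // => j ji.
by rewrite ffunE (negbTE ji) expr0.
Qed.

Lemma hpolyD k m m' p q : hpoly k m p -> hpoly k m' q ->
  hpoly k (m + m') (fun h => p h + q h).
Proof.
move=> [s [sk ps sm]] [s' [sk' qs sm']]; exists (s ++ s'); split=> [t|h|].
- by rewrite mem_cat => /orP[/sk|/sk'].
- by rewrite big_cat /= ps qs.
- by rewrite big_cat lerD.
Qed.

Lemma hpoly_sum (I : Type) (r : seq I) (P : pred I) k (m : I -> R) (p : I -> V -> R) :
  (forall i, P i -> hpoly k (m i) (p i)) ->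
  hpoly k (\sum_(i <- r | P i) m i) (fun h => \sum_(i <- r | P i) p i h).
Proof.
move=> pk; elim: r => [|i r IH].
  by rewrite big_nil (_ : (fun=> _) = fun=> 0) ?funeqE => [|h]; rewrite ?big_nil //; exact: hpoly0.
rewrite big_cons (_ : (fun h : V => _) = fun h => if P i
    then p i h + \sum_(j <- r | P j) p j h else \sum_(j <- r | P j) p j h).
  by case: ifP => // /pk pi; apply: hpolyD.
by apply/funext => h; rewrite big_cons.
Qed.

Lemma hpolyM k l m m' p q : hpoly k m p -> hpoly l m' q ->
  hpoly (k + l) (m * m') (fun h => p h * q h).
Proof.
move=> [s [sk ps sm]] [s' [sk' qs sm']].
exists [seq (a.1 * b.1, [ffun i => (a.2 i + b.2 i)%N]) |
  a : R * {ffun 'I_N -> nat} <- s, b : R * {ffun 'I_N -> nat} <- s'].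
split=> [t|h|].
- move=> /allpairsP[[a b] [/sk <- /sk' <- ->]] /=.
  by rewrite -big_split; apply: eq_bigr => i _; rewrite ffunE.
- rewrite ps qs big_allpairs_dep big_distrl /=; apply: eq_bigr => a _.
  rewrite big_distrr /=; apply: eq_bigr => b _.
  have -> : monom [ffun i => (a.2 i + b.2 i)%N] h = monom a.2 h * monom b.2 h.
    by rewrite /monom -big_split; apply: eq_bigr => i _; rewrite ffunE exprD.
  by rewrite mulrACA.
- rewrite big_allpairs_dep /=.
  under eq_bigr do under eq_bigr do rewrite normrM.
  under eq_bigr do rewrite -mulr_sumr.
  by rewrite -mulr_suml ler_pM // sumr_ge0.
Qed.

Lemma hpolyZ k m p a : hpoly k m p -> hpoly k (`|a| * m) (fun h => a * p h).
Proof. exact: hpolyM (hpoly_cst a). Qed.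

Lemma monom_le b h (t : R) : (forall i, `|coordinate i h| <= t) ->
  `|monom b h| <= t ^+ (\sum_i b i).
Proof.
move=> ht; rewrite /monom normr_prod -prodrXr.
by apply: ler_prod => i _; rewrite normr_ge0 normrX lerXn2r ?nnegrE ?(le_trans _ (ht i)).
Qed.

Lemma hpoly_bound k m p h (t : R) : 0 <= t -> (forall i, `|coordinate i h| <= t) ->
  hpoly k m p -> `|p h| <= m * t ^+ k.
Proof.
move=> t0 ht [s [sk ps sm]]; rewrite ps; apply: (le_trans (ler_norm_sum _ _ _)).
apply: (@le_trans _ _ (\sum_(a <- s) `|a.1| * t ^+ k)).
  rewrite !big_seq; apply: ler_sum => a /sk <-.
  by rewrite normrM ler_wpM2l // monom_le.
by rewrite -mulr_suml ler_wpM2r // exprn_ge0.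
Qed.

(** Passage from lists of terms, in which monomials may repeat, to the coefficient family of
    [analytic_at]. One family serves all degrees because a multi-index determines its degree, and
    merging repeated monomials can only decrease the sum of absolute values. *)
Lemma hpoly_coef (m : nat -> R) (p : nat -> V -> R) :
    (forall k, hpoly k (m k) (p k)) ->
  exists c : {ffun 'I_N -> nat} -> R, forall k,
    (forall h, \sum_(a : {ffun 'I_N -> 'I_k.+1} | (\sum_i a i)%N == k)
       (\prod_i coordinate i h ^+ a i) * c [ffun i => a i : nat] = p k h) /\
    \sum_(a : {ffun 'I_N -> 'I_k.+1} | (\sum_i a i)%N == k)
       `|c [ffun i => a i : nat]| <= m k.
Proof.
move=> /choice[s sP].
exists (fun b : {ffun _ -> nat} => \sum_(t <- s (\sum_i b i)%N | t.2 == b) t.1) => k.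
have [sk ps sm] := sP k.
pose ca (a : {ffun 'I_N -> 'I_k.+1}) := [ffun i => a i : nat].
have deg a : (\sum_i ca a i = \sum_i a i)%N by apply: eq_bigr => i _; rewrite ffunE.
(* A monomial of degree k comes from exactly one index a. *)
have uniq_a (t : R * {ffun 'I_N -> nat}) (F : {ffun 'I_N -> 'I_k.+1} -> R) (x : R) : t \in s k ->
    (forall a, t.2 = ca a -> F a = x) ->
    \sum_(a : {ffun 'I_N -> 'I_k.+1} | ((\sum_i a i)%N == k) && (t.2 == ca a)) F a = x.
  move=> ts Fx.
  pose a0 : {ffun 'I_N -> 'I_k.+1} := [ffun i => inord (t.2 i)].
  have ta0 : t.2 = ca a0.
    apply/ffunP => i; rewrite !ffunE inordK // ltnS -(sk _ ts) (bigD1 i) //=.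
    exact: leq_addr.
  rewrite (big_pred1 a0) ?Fx // => a /=; apply/andP/eqP => [[_ /eqP ta]|->].
    apply/ffunP => i; apply: val_inj; move: ta; rewrite ta0 => /ffunP/(_ i).
    by rewrite !ffunE.
  by rewrite -ta0 eqxx -deg -ta0 sk.
split=> [h|].
  under eq_bigr => a /eqP ak do rewrite deg ak big_distrr /=.
  rewrite (exchange_big_dep xpredT) //= ps big_seq [RHS]big_seq; apply: eq_bigr => t ts.
  apply: uniq_a => // a ta; rewrite mulrC ta; congr (_ * _).
  by apply: eq_bigr => i _; rewrite ffunE.
apply: le_trans sm.
apply: (@le_trans _ _ (\sum_(a : {ffun 'I_N -> 'I_k.+1} | (\sum_i a i)%N == k)
    \sum_(t <- s k | t.2 == ca a) `|t.1|)).
  by apply: ler_sum => a /eqP ak; rewrite deg ak ler_norm_sum.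
rewrite (exchange_big_dep xpredT) //= big_seq [leRHS]big_seq; apply: ler_sum => t ts.
by rewrite (uniq_a _ _ `|t.1|).
Qed.

End HomogeneousPolynomials.

Lemma mx_entry_norm (R : realType) m n (A : 'M[R]_(m, n)) i j : `|A i j| <= `|A|.
Proof.
rewrite [leRHS]/Num.norm /= mx_normrE; apply/bigmax_geP; right.
by exists (i, j).
Qed.

Lemma continuous_sum (R : realType) (T : topologicalType) (W : normedModType R)
    (I : Type) (r : seq I) (P : pred I) (F : I -> T -> W) :
  (forall i, P i -> continuous (F i)) ->
  continuous (fun x => \sum_(i <- r | P i) F i x).
Proof. by move=> cF; apply: continuous_big => //; exact: add_continuous. Qed.

(** * Coordinates are controlled by the norm *)

Section Coordinates.
Context (R : realType) (V : normedVectType R).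
Local Notation N := (\dim {:V}).
Local Notation coordinate i h := (coord (vbasis {:V}) i h).

(* The norm restricted to the unit sphere of the coordinate space attains a
   positive minimum. *)
Lemma coord_le_norm : exists2 K : R, 0 < K &
  forall i (h : V), `|coordinate i h| <= K * `|h|.
Proof.
pose vec (a : 'rV[R]_N) : V := \sum_i a 0 i *: (vbasis {:V})`_i.
have vecZ k a : vec (k *: a) = k *: vec a.
  by rewrite /vec scaler_sumr; apply: eq_bigr => i _; rewrite mxE scalerA.
pose S := [set a : 'rV[R]_N | `|a| = 1].
have cont_vec : continuous (fun a => `|vec a|).
  suff cvec : continuous vec.
    move=> a; apply: (@continuous_comp _ _ _ vec (fun v : V => `|v|)); first exact: cvec.
    exact: norm_continuous.
  apply: (@continuous_sum _ _ V _ _ _ (fun i (a : 'rV[R]_N) => a 0 i *: _)) => i _ b.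
  have ci := @coord_continuous R 1 N 0 i.
  exact: cvgZr_tmp (ci b).
have cS : compact S.
  apply: bounded_closed_compact; last first.
    have cn : continuous (fun a : 'rV[R]_N => `|a|) := @norm_continuous _ _.
    have -> : S = (fun a : 'rV[R]_N => `|a|) @^-1` [set 1] by [].
    move/continuous_closedP : cn; apply; exact: closed_eq.
  by exists 1; split => // M M1 a /= ->; exact: ltW.
have vec_coord h : vec (\row_i coordinate i h) = h.
  by rewrite /vec [RHS](coord_vbasis (memvf h)); apply: eq_bigr => i _; rewrite mxE.
have normalize (a : 'rV[R]_N) : a != 0 -> S (`|a|^-1 *: a).
  by move=> a0; rewrite /S /= normrZ normfV normr_id mulVf // normr_eq0.
(* On an empty sphere there is no minimum to take, but then every coordinate vector is 0, since a
   nonzero one could be normalized into [S]. *)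
have [S0|/set0P S0] := eqVneq S set0.
  exists 1 => // i h; have [a0|/normalize] := eqVneq (\row_i coordinate i h) 0.
    by have /rowP/(_ i) := a0; rewrite !mxE => ->; rewrite normr0 mul1r.
  by rewrite S0.
have [a /set_mem aS amin] := compact_EVT_min S0 cS (continuous_subspaceT cont_vec).
have va0 : 0 < `|vec a|.
  have /freeP fr := basis_free (vbasisP {:V}).
  rewrite normr_gt0; apply/eqP => /fr a0.
  have : a = 0 by apply/rowP => i; rewrite a0 mxE.
  by move=> a00; move: aS; rewrite /S /= a00 normr0 => /esym/eqP; rewrite oner_eq0.
exists `|vec a|^-1; rewrite ?invr_gt0 // => i h.
rewrite mulrC ler_pdivlMr //; set b := \row_i coordinate i h.
have -> : coordinate i h = b 0 i by rewrite mxE.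
have [->|b0] := eqVneq b 0; first by rewrite mxE normr0 mul0r.
have := amin _ (mem_set (normalize _ b0)).
rewrite vecZ vec_coord normrZ normfV normr_id mulrC ler_pdivlMr ?normr_gt0 //.
by apply: le_trans; rewrite mulrC ler_wpM2l // mx_entry_norm.
Qed.

Lemma near0_coord t : 0 < t -> \forall h \near (0 : V), forall i, `|coordinate i h| <= t.
Proof.
move=> t0; have [K K0 KP] := coord_le_norm.
near=> h => i; apply: (le_trans (KP i h)); rewrite -ler_pdivlMl //.
near: h; apply: (@cvgr0_norm_le _ _ _ _ _ id); first exact: cvg_id.
by rewrite mulr_gt0 ?invr_gt0.
Unshelve. all: by end_near. Qed.

End Coordinates.

Lemma series_finite (R : realType) (u : nat -> R) m :
  (forall k, (m <= k)%N -> u k = 0) -> series u @ \oo --> \sum_(0 <= k < m) u k.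
Proof.
move=> u0; apply: cvg_near_cst; exists m => // n /= mn.
have um : \sum_(m <= k < n) u k = 0.
  by rewrite big_nat_cond big1 // => i /andP[/andP[mi _] _]; exact: u0.
by rewrite /series /= (big_cat_nat _ mn) //= um addr0.
Qed.

(** * Analytic functions *)

Section GeometricAnalyticity.
Context (R : realType) (V : normedVectType R).
Local Notation N := (\dim {:V}).
Local Notation coordinate i h := (coord (vbasis {:V}) i h).
Implicit Types (f g u : V -> R) (x y h : V).

(* A strengthening of analytic_at for real-valued functions: the geometric bound on
   the coefficients makes the closure properties elementary. *)
Definition ganalytic f x := exists (p : nat -> V -> R) (C r : R),
  [/\ 0 < r, forall k, hpoly k (C * r ^+ k) (p k) &
      \forall h \near (0 : V), series (p ^~ h) @ \oo --> f (x + h)].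

Lemma near_translate x (P : set V) :
  (\forall y \near x, P y) <-> (\forall h \near (0 : V), P (x + h)).
Proof.
rewrite (near_shift 0 x) subr0.
by split; apply: filterS => h /=; rewrite addrC.
Qed.

Lemma ganalytic_near f g x :
  (\forall y \near x, f y = g y) -> ganalytic f x -> ganalytic g x.
Proof.
move=> /near_translate fg [p [C [r [r0 pk pf]]]]; exists p, C, r; split=> //.
by apply: filterS2 fg pf => h ->.
Qed.

(** Adding the two constants and the two rates dominates both expansions, so the closure proofs can
    work with one common bound. *)
Lemma ganalytic_two f g x : ganalytic f x -> ganalytic g x ->
  exists (p q : nat -> V -> R) (C r : R),
  [/\ 0 <= C /\ 0 < r, forall k, hpoly k (C * r ^+ k) (p k),
      forall k, hpoly k (C * r ^+ k) (q k),
      \forall h \near (0 : V), series (p ^~ h) @ \oo --> f (x + h) &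
      \forall h \near (0 : V), series (q ^~ h) @ \oo --> g (x + h)].
Proof.
move=> [p [C [r [r0 pk pf]]]] [q [D [s [s0 qk qg]]]].
have C0 : 0 <= C by have := hpoly_ge0 (pk 0%N); rewrite mulr1.
have D0 : 0 <= D by have := hpoly_ge0 (qk 0%N); rewrite mulr1.
exists p, q, (C + D), (r + s); split=> //; first by split; [exact: addr_ge0|exact: addr_gt0].
- move=> k; apply: hpoly_le (pk k); apply: ler_pM; rewrite ?exprn_ge0 ?(ltW r0) ?lerDl //.
  by rewrite lerXn2r ?nnegrE ?addr_ge0 ?lerDl // ltW.
- move=> k; apply: hpoly_le (qk k); apply: ler_pM; rewrite ?exprn_ge0 ?(ltW s0) ?lerDr //.
  by rewrite lerXn2r ?nnegrE ?addr_ge0 ?lerDr // ltW.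
Qed.

Lemma ganalytic_scalar f x : scalar f -> ganalytic f x.
Proof.
move=> fl; pose F : {scalar V} := HB.pack f (GRing.isLinear.Build R V R *%R f fl).
have fE h : f h = \sum_(i < N) F (vbasis {:V})`_i * coordinate i h.
  rewrite -[f h]/(F h) {1}(coord_vbasis (memvf h)) linear_sum.
  by apply: eq_bigr => i _; rewrite linearZ /= mulrC.
pose S := \sum_(i < N) `|F (vbasis {:V})`_i|.
have S0 : 0 <= S by exact: sumr_ge0.
exists (fun k h => if k is 0 then f x else if k is 1 then f h else 0), (`|f x| + S), 1.
split=> // [[|[|k]]|]; rewrite ?expr1n ?mulr1.
- by apply: hpoly_le (hpoly_cst _ _); rewrite lerDl.
- apply: (@hpoly_le _ _ _ S); first by rewrite lerDr.
  rewrite (_ : (fun h => f h) = fun h => \sum_(i < N) F (vbasis {:V})`_i * coordinate i h).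
    apply: hpoly_sum => i _; rewrite -[`|_|]mulr1.
    exact/hpolyZ/hpoly_coord.
  by apply/funext => h; rewrite fE.
- by apply: hpoly_le (hpoly0 _ _); rewrite addr_ge0.
apply: nearW => h.
have -> : f (x + h) = \sum_(0 <= k < 2) (if k is 0 then f x else if k is 1 then f h else 0).
  by rewrite big_nat_recr //= big_nat1 -[f _]/(F _) raddfD.
by apply: series_finite => -[|[|]].
Qed.

Lemma ganalytic_cst a x : ganalytic (fun=> a) x.
Proof.
exists (fun k h => if k is 0 then a else 0), `|a|, 1.
split=> // [[|k]|]; rewrite ?expr1n ?mulr1; first exact: hpoly_cst.
  by apply: hpoly_le (hpoly0 _ _).
apply: nearW => h.
have {2}-> : a = \sum_(0 <= k < 1) (if k is 0 then a else 0) by rewrite big_nat1.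
by apply: series_finite => -[].
Qed.

Lemma ganalyticD f g x : ganalytic f x -> ganalytic g x ->
  ganalytic (fun y => f y + g y) x.
Proof.
move=> fx gx; have [p [q [C [r [[C0 r0] pk qk pf qg]]]]] := ganalytic_two fx gx.
exists (fun k h => p k h + q k h), (C + C), r; split=> // [k|].
  by rewrite mulrDl; apply: hpolyD.
apply: filterS2 pf qg => h pf qg.
rewrite (_ : series _ = series (p^~ h) + series (q^~ h)); first exact: cvgD.
by apply/funext => n; rewrite /series /= big_split.
Qed.

Lemma ganalyticM f g x : ganalytic f x -> ganalytic g x ->
  ganalytic (fun y => f y * g y) x.
Proof.
move=> fx gx; have [p [q [C [r [[C0 r0] pk qk pf qg]]]]] := ganalytic_two fx gx.
(* Degree [k] collects [k.+1] products, each with bound [C * C * r ^+ k]; doubling the rate pays for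
   their number, as [k.+1 <= 2 ^ k]. *)
exists (fun k h => conv (p^~ h) (q^~ h) k), (C * C), (2 * r); split=> [|k|].
- by rewrite mulr_gt0.
- apply: (@hpoly_le _ _ _ (\sum_(i < k.+1) (C * r ^+ i) * (C * r ^+ (k - i)))).
    rewrite (eq_bigr (fun=> C * C * r ^+ k)); last first.
      by move=> i _; rewrite mulrACA -exprD subnKC // -ltnS.
    rewrite sumr_const card_ord -[leLHS]mulr_natr exprMn -mulrA ler_wpM2l ?mulr_ge0 //.
    by rewrite mulrC ler_wpM2r ?exprn_ge0 ?(ltW r0) // -natrX ler_nat ltn_expl.
  apply: (@hpoly_sum _ _ _ _ _ _ _ (fun (i : 'I_k.+1) h => p i h * q (k - i)%N h)) => i _.
  rewrite -{1}(subnKC (ltn_ord i : (i <= k)%N)); exact: hpolyM.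
(* At coordinates of this size [C * r ^+ k] turns into the bound [C * 4^-1 ^+ k] that
   [cauchy_product] expects. *)
have t0 : 0 < (4 * r)^-1 by rewrite invr_gt0 mulr_gt0.
have bnd (s : nat -> V -> R) h : (forall i, `|coordinate i h| <= (4 * r)^-1) ->
    (forall k, hpoly k (C * r ^+ k) (s k)) -> forall k, `|s k h| <= C * 4^-1 ^+ k.
  move=> hc sk k; apply: (le_trans (hpoly_bound (ltW t0) hc (sk k))).
  by rewrite -mulrA -exprMn invfM mulrCA mulfV ?mulr1 // gt_eqF.
apply: filterS3 (near0_coord V t0) pf qg => h hc.
by apply: (@cauchy_product _ _ _ C); exact: bnd.
Qed.

Lemma ganalytic_sum (I : Type) (s : seq I) (P : pred I) (F : I -> V -> R) x :
  (forall i, P i -> ganalytic (F i) x) -> ganalytic (fun y => \sum_(i <- s | P i) F i y) x.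
Proof.
move=> Fx; elim: s => [|i s IH].
  by apply: ganalytic_near (ganalytic_cst 0 x); apply: nearW => y; rewrite big_nil.
have [Pi|nPi] := boolP (P i); last first.
  by apply: ganalytic_near IH; apply: nearW => y; rewrite big_cons (negbTE nPi).
apply: ganalytic_near (ganalyticD (Fx i Pi) IH).
by apply: nearW => y; rewrite big_cons Pi.
Qed.

Lemma ganalyticZ a f x : ganalytic f x -> ganalytic (fun y => a * f y) x.
Proof. by move=> fx; apply: ganalyticM => //; exact: ganalytic_cst. Qed.

Lemma ganalyticB f g x : ganalytic f x -> ganalytic g x ->
  ganalytic (fun y => f y - g y) x.
Proof.
move=> fx gx; apply: ganalytic_near (ganalyticD fx (ganalyticZ (-1) gx)).
by apply: nearW => y; rewrite mulN1r.
Qed.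

End GeometricAnalyticity.

(** * Quadratic equations in power series; inverses and square roots *)

Section Riccati.
Context (R : realType) (V : normedVectType R).
Local Notation N := (\dim {:V}).
Local Notation coordinate i h := (coord (vbasis {:V}) i h).
Implicit Types (f g u : V -> R) (x y h : V).

Lemma hpoly_const m p h h' : hpoly 0 m p -> p h = p h' :> R.
Proof.
move=> [s [s0 ps _]]; rewrite !ps big_seq [RHS]big_seq; apply: eq_bigr => e /s0/eqP.
rewrite sum_nat_eq0 => /forallP e0; congr (_ * _).
by apply: eq_bigr => i _; rewrite (eqP (e0 i)) !expr0.
Qed.

Lemma series_le4 (w : nat -> R) C : (forall k, `|w k| <= C * 4^-1 ^+ k) ->
  cvgn (series w) /\ `|limn (series w)| <= C * 2.
Proof.
move=> wC; have C0 : 0 <= C by have := wC 0%N; rewrite expr0 mulr1; apply: le_trans.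
have wcv : cvgn (series w).
  apply: normed_cvg; apply: (series_le_cvg _ _ wC) => [//|k|].
    by rewrite mulr_ge0 // exprn_ge0 // invr_ge0.
  by apply: is_cvg_geometric_series; rewrite gtr0_norm ?invf_lt1 ?ltr1n ?invr_gt0.
split=> //; rewrite -lim_norm //; apply: limr_le; first exact: is_cvg_norm.
apply: nearW => n; apply: (le_trans (ler_norm_sum _ _ _)).
apply: (@le_trans _ _ (\sum_(0 <= k < n) C * 4^-1 ^+ k)); first exact: ler_sum.
rewrite -mulr_sumr ler_wpM2l //.
by apply: (le_trans (sum_geo4_le _ _ _)); rewrite expr0 mulr1.
Qed.

(** The majorant principle, by strong induction on the degree: bounds add and multiply along the
    recursion, and the coefficients [a], [b], [c] are dominated by 1. *)
Lemma hpoly_riccati (p : nat -> V -> R) (M : nat -> R) a b c k :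
    `|a| <= 1 -> `|b| <= 1 -> `|c| <= 1 -> (forall k, hpoly k (M k) (p k)) ->
  hpoly k (riccati 1 1 1 M k) (fun h => riccati a b c (p^~ h) k).
Proof.
move=> a1 b1 c1 pM; elim/ltn_ind: k => k IH; rewrite riccatiE.
rewrite (_ : (fun h => _) = fun h => a * p k h +
    \sum_(i < k.+1 | (0 < i < k)%N) (b * p i h + c * riccati a b c (p^~ h) i) *
      riccati a b c (p^~ h) (k - i)%N); last first.
  by apply/funext => h; rewrite riccatiE.
apply: hpolyD; first by apply: hpoly_le (hpolyZ a (pM k)); rewrite ler_wpM2r ?(hpoly_ge0 (pM k)).
apply: (@hpoly_sum _ _ _ _ _ _ _ (fun (i : 'I_k.+1) h =>
  (b * p i h + c * riccati a b c (p^~ h) i) * riccati a b c (p^~ h) (k - i)%N)) => i /andP[i0 ik].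
have ki : (k - i < k)%N by rewrite ltn_subrL i0 (leq_ltn_trans _ ik).
rewrite -{1}(subnKC (ltnW ik)); apply: hpolyM (IH _ ki).
apply: hpolyD.
  by apply: hpoly_le (hpolyZ b (pM i)); rewrite ler_wpM2r ?(hpoly_ge0 (pM i)).
by apply: hpoly_le (hpolyZ c (IH _ ik)); rewrite ler_wpM2r ?(hpoly_ge0 (IH _ ik)).
Qed.

(** The formal solution converges near [x] by the majorant bound, and Cauchy products carry the
    equation to its sum. The bound on [v] is kept for the square root, where it decides a sign. *)
Lemma ganalytic_riccati u x a b c : ganalytic u x -> u x = 0 ->
    `|a| <= 1 -> `|b| <= 1 -> `|c| <= 1 ->
  exists2 v, ganalytic v x &
    \forall y \near x, `|v y| <= 2^-1 /\
                       v y = a * u y + (b * (u y * v y) + c * (v y * v y)).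
Proof.
move=> [p [C [r [r0 pk pu]]]] ux0 a1 b1 c1.
have C0 : 0 <= C by have := hpoly_ge0 (pk 0%N); rewrite mulr1.
(* The degree 0 part is constant, and at [h = 0] it is the only surviving term of a series with sum
   [u x = 0]. *)
have p0 h : p 0 h = 0.
  rewrite (hpoly_const h 0 (pk 0%N)).
  have := nbhs_singleton pu; rewrite addr0 ux0.
  have pk0 k : (0 < k)%N -> p k 0 = 0.
    move=> k0; apply/eqP; rewrite -normr_le0.
    have := @hpoly_bound _ _ _ _ _ 0 0 (lexx _) _ (pk k).
    rewrite expr0n eqn0Ngt k0 mulr0; apply => i.
    by rewrite linear0 normr0.
  move=> pu0; have pp0 := @series_finite _ (p^~ 0) 1 pk0.
  by have := cvg_unique _ pu0 pp0; rewrite big_nat1 => <-.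
(* Chosen so that [q <= 4^-1] and [2 * C * q <= 8^-1]. With [rho = q / r] the majorant of [u], which
   starts in degree 1, is at most [C * q] times a geometric sum bounded by 2, hence meets the
   hypothesis of [riccati_sum_le]. *)
pose q := (16 * C + 4)^-1.
have q0 : 0 < q by rewrite invr_gt0; lra.
have q4 : q <= 4^-1 by rewrite lef_pV2 ?posrE; lra.
have Cq : 2 * C * q <= 8^-1 by rewrite ler_pdivrMr; lra.
pose rho := q / r; have rho0 : 0 < rho by rewrite divr_gt0.
pose M k := if k is 0 then 0 else C * r ^+ k.
have M0 k : 0 <= M k by case: k => // k; rewrite mulr_ge0 // exprn_ge0 // ltW.
have pM k : hpoly k (M k) (p k).
  case: k => [|k]; last exact: pk.
  by rewrite (_ : p 0 = fun=> 0); [exact: hpoly0|apply/funext].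
have Mle n : \sum_(0 <= k < n) M k * rho ^+ k <= 8^-1.
  case: n => [|n]; first by rewrite big_geq // invr_ge0.
  rewrite big_nat_recl // mul0r add0r; apply: le_trans Cq.
  apply: (@le_trans _ _ (\sum_(0 <= k < n) C * q * 4^-1 ^+ k)).
    apply: ler_sum => k _; rewrite /M /rho -mulrA -exprMn mulrCA mulfV ?gt_eqF // mulr1.
    rewrite exprS mulrA ler_wpM2l ?mulr_ge0 ?(ltW q0) // lerXn2r ?nnegrE ?(ltW q0) ?invr_ge0 //.
  rewrite -mulr_sumr -[leRHS]mulrA [leRHS]mulrC ler_wpM2l ?mulr_ge0 ?(ltW q0) //.
  by apply: (le_trans (sum_geo4_le _ _ _)); rewrite expr0 mulr1.
pose m := riccati 1 1 1 M.
have m0 k : 0 <= m k by exact: riccati_ge0.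
(* A single term of a sum of nonnegative terms is at most the bound 1/4 on the whole sum. *)
have mle k : m k <= 4^-1 * rho^-1 ^+ k.
  rewrite exprVn ler_pdivlMr ?exprn_gt0 //.
  have := @riccati_sum_le _ M rho k.+1 (ltW rho0) erefl M0 Mle; rewrite big_nat_recr //=.
  apply: le_trans; rewrite lerDr sumr_ge0 // => i _.
  by rewrite mulr_ge0 ?exprn_ge0 // ltW.
pose w k h := riccati a b c (p^~ h) k.
have wk k : hpoly k (4^-1 * rho^-1 ^+ k) (w k).
  by apply: hpoly_le (mle k) _; exact: hpoly_riccati.
(* At this size the terms of [w] are bounded by [4^-1 * 4^-1 ^+ k]; those of [p] by [C * 4^-1 ^+ k],
   because [r * rho = q <= 1]. *)
have t0 : 0 < rho / 4 by rewrite divr_gt0.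
have wle h : (forall i, `|coordinate i h| <= rho / 4) ->
    forall k, `|w k h| <= 4^-1 * 4^-1 ^+ k.
  move=> hc k; apply: (le_trans (hpoly_bound (ltW t0) hc (wk k))).
  by rewrite -mulrA -exprMn mulrA mulVf ?gt_eqF // mul1r.
have ple h : (forall i, `|coordinate i h| <= rho / 4) ->
    forall k, `|p k h| <= C * 4^-1 ^+ k.
  move=> hc k; apply: (le_trans (hpoly_bound (ltW t0) hc (pk k))).
  have rt0 : 0 <= r * (rho / 4) by rewrite mulr_ge0 ?(ltW r0) ?(ltW t0).
  rewrite -mulrA -exprMn ler_wpM2l // lerXn2r // ?nnegrE ?invr_ge0 //.
  by rewrite mulrA /rho mulrCA mulfV ?gt_eqF // mulr1 ler_piMl //; lra.
exists (fun y => limn (series (w^~ (y - x)))).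
  exists w, 4^-1, rho^-1; split=> //; first by rewrite invr_gt0.
  apply: filterS (near0_coord V t0) => h hc.
  rewrite addrAC subrr add0r; exact: (series_le4 (wle h hc)).1.
apply/near_translate; apply: filterS2 (near0_coord V t0) pu => h hc ph.
rewrite (addrAC x) subrr add0r.
have [wcv wb] := series_le4 (wle h hc); set l := limn _ in wb *.
split; first by apply: (le_trans wb); lra.
have ccp := ple h hc; have ccw := wle h hc.
have up (s : nat -> R) D : 0 <= D -> (forall k, `|s k| <= D * 4^-1 ^+ k) ->
    forall E, D <= E -> forall k, `|s k| <= E * 4^-1 ^+ k.
  by move=> D0 sD E DE k; apply: (le_trans (sD k)); rewrite ler_wpM2r ?exprn_ge0 ?invr_ge0.
have q40 : 0 <= 4^-1 :> R by rewrite invr_ge0.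
have pE := up _ _ C0 ccp (C + 4^-1) ltac:(by rewrite lerDl).
have wE := up _ _ q40 ccw (C + 4^-1) ltac:(by rewrite lerDr).
have uv := cauchy_product pE wE ph wcv.
have vv := cauchy_product wE wE wcv wcv.
have rhs : (a *: series (p^~ h) + (b *: series (conv (p^~ h) (w^~ h)) +
    c *: series (conv (w^~ h) (w^~ h)))) @ \oo -->
    a * u (x + h) + (b * (u (x + h) * l) + c * (l * l)).
  by apply: cvgD; [exact: cvgZl_tmp|apply: cvgD; exact: cvgZl_tmp].
have wE' : series (w^~ h) = a *: series (p^~ h) +
    (b *: series (conv (p^~ h) (w^~ h)) + c *: series (conv (w^~ h) (w^~ h))).
  apply/funext => n; rewrite /series /= !fctE /= !scaler_sumr -!big_split /=.
  by apply: eq_bigr => k _; rewrite /w riccati_conv.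
by rewrite -wE' in rhs; exact: (cvg_unique _ wcv rhs).
Qed.

(** Dividing by [f x] moves the value at [x] to 1: [f y = f x * (1 - u y)] with [u x = 0], as the
    quadratic equation requires. *)
Lemma ganalyticV f x : f x != 0 -> ganalytic f x -> ganalytic (fun y => (f y)^-1) x.
Proof.
move=> fx0 fx; pose u y := 1 - (f x)^-1 * f y.
have ux : ganalytic u x by apply: ganalyticB; [exact: ganalytic_cst|exact: ganalyticZ].
have ux0 : u x = 0 by rewrite /u mulVf // subrr.
have [||| v vx vu] := @ganalytic_riccati u x 1 1 0 ux ux0; rewrite ?normr1 ?normr0 //.
apply: ganalytic_near (ganalyticZ (f x)^-1 (ganalyticD (ganalytic_cst 1 x) vx)).
apply: filterS vu => y [_]; rewrite mul0r addr0 !mul1r => vE.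
have : (1 + v y) * (1 - u y) = 1 by rewrite mulrBr mulrDl mul1r {1}vE; ring.
rewrite /u subKr mulrA => fv.
(* The product identity just obtained itself shows that [f] has no zero near [x]. *)
have fy0 : f y != 0.
  by apply/eqP => fy0; move: fv; rewrite fy0 mulr0 => /esym/eqP; rewrite oner_eq0.
by apply: (mulIf fy0); rewrite mulVf // -[RHS]fv; ring.
Qed.

Lemma ganalytic_sqrt f x : 0 < f x -> ganalytic f x ->
  ganalytic (fun y => Num.sqrt (f y)) x.
Proof.
move=> fx0 fx; pose u y := 1 - (f x)^-1 * f y.
have ux : ganalytic u x by apply: ganalyticB; [exact: ganalytic_cst|exact: ganalyticZ].
have ux0 : u x = 0 by rewrite /u mulVf ?gt_eqF // subrr.
have half : `|2^-1 : R| <= 1 by rewrite ger0_norm ?invr_ge0 // invf_le1 // ler1n.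
have [||| v vx vu] := @ganalytic_riccati u x 2^-1 0 2^-1 ux ux0; rewrite ?normr0 //.
apply: ganalytic_near (ganalyticZ (Num.sqrt (f x)) (ganalyticB (ganalytic_cst 1 x) vx)).
apply: filterS vu => y [v1]; rewrite mul0r add0r => vE.
(* The equation determines only the square of [1 - v y]; its sign identifies it with the square
   root. *)
have v0 : 0 <= 1 - v y by move: v1; rewrite ler_norml => /andP[_]; lra.
have fE : f y = f x * (1 - v y) ^+ 2.
  have -> : (1 - v y) ^+ 2 = 1 - u y by rewrite expr2; nra.
  by rewrite /u subKr mulrA mulfV ?gt_eqF // mul1r.
by rewrite fE sqrtrM ?(ltW fx0) // sqrtr_sqr ger0_norm.
Qed.

End Riccati.

(** The bridge from the scalar notion [ganalytic] to [analytic_at]: a vector-valued map is expanded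
    along finitely many fixed vectors, later the elementary matrices, and the scalar coefficients
    are recombined along them. *)
Lemma analytic_at_lincomb (R : realType) (V : normedVectType R) (W : normedModType R)
    (I : finType) (f : I -> V -> R) (w : I -> W) (g : V -> W) (x : V) :
    (forall i, ganalytic (f i) x) -> (forall y, g y = \sum_i f i y *: w i) ->
  analytic_at g x.
Proof.
move=> fx gE.
have /choice[p /choice[C /choice[r P]]] := fx.
have /choice[c cP] : forall i, exists c : {ffun 'I_(\dim {:V}) -> nat} -> R, forall k,
    (forall h, \sum_(a : {ffun 'I_(\dim {:V}) -> 'I_k.+1} | (\sum_j a j)%N == k)
       (\prod_j coord (vbasis {:V}) j h ^+ a j) * c [ffun j => a j : nat] = p i k h) /\
    \sum_(a : {ffun 'I_(\dim {:V}) -> 'I_k.+1} | (\sum_j a j)%N == k)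
       `|c [ffun j => a j : nat]| <= C i * r i ^+ k.
  by move=> i; apply: hpoly_coef; case: (P i).
exists (fun a => \sum_i c i a *: w i).
have partE h k : homog_part (fun a => \sum_i c i a *: w i) h k = \sum_i p i k h *: w i.
  rewrite /homog_part; under eq_bigr do rewrite scaler_sumr.
  rewrite exchange_big /=; apply: eq_bigr => i _.
  rewrite -(cP i k).1 scaler_suml; apply: eq_bigr => a _.
  by rewrite scalerA.
pose S := \sum_i r i; have r0 i : 0 < r i by case: (P i).
have S0 : 0 <= S by apply: sumr_ge0 => i _; exact: ltW.
have rS i : r i <= S by rewrite /S (bigD1 i) //= lerDl sumr_ge0 // => j _; exact: ltW.
have C0 i : 0 <= C i by case: (P i) => _ /(_ 0%N)/hpoly_ge0; rewrite mulr1.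
(* Makes [S * t <= 4^-1], so the series of absolute values is dominated by [D * 4^-1 ^+ k]; the
   summand 1 keeps the denominator positive when [I] is empty. *)
pose t := (4 * (S + 1))^-1.
have t0 : 0 < t by rewrite invr_gt0; lra.
have St : S * t <= 4^-1 by rewrite ler_pdivrMr ; lra.
pose D := \sum_i C i * `|w i|.
have D0 : 0 <= D by apply: sumr_ge0 => i _; rewrite mulr_ge0.
have ncv : \forall h \near (0 : V), forall i, series (p i ^~ h) @ \oo --> f i (x + h).
  by apply: filter_forall => i; case: (P i).
apply: filterS2 (near0_coord V t0) ncv => h hc hf; split; last first.
  rewrite gE (_ : series _ = fun n => \sum_i series (p i ^~ h) n *: w i).
    by apply: cvg_big => [|i _]; [exact: add_continuous|exact: cvgZr_tmp].
  apply/funext => n; rewrite /series /=.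
  under [RHS]eq_bigr do rewrite scaler_suml.
  by rewrite exchange_big /=; apply: eq_bigr => k _; rewrite partE.
have coef_le k : \sum_(a : {ffun 'I_(\dim {:V}) -> 'I_k.+1} | (\sum_j a j)%N == k)
    `|\sum_i c i [ffun j => a j : nat] *: w i| <= D * S ^+ k.
  apply: (@le_trans _ _ (\sum_(a : {ffun 'I_(\dim {:V}) -> 'I_k.+1} | (\sum_j a j)%N == k)
      \sum_i `|c i [ffun j => a j : nat]| * `|w i|)).
    apply: ler_sum => a _; apply: (le_trans (ler_norm_sum _ _ _)).
    by apply: ler_sum => i _; rewrite normrZ.
  rewrite exchange_big /= /D mulr_suml; apply: ler_sum => i _.
  rewrite -mulr_suml mulrAC ler_wpM2r //; apply: (le_trans (cP i k).2).
  by rewrite ler_wpM2l // lerXn2r ?nnegrE // ltW.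
apply: (@series_le_cvg _ _ (geometric D 4^-1)) => [k|k|k|].
- by apply: sumr_ge0 => a _; rewrite mulr_ge0 // prodr_ge0 // => i _; rewrite exprn_ge0.
- by rewrite /geometric /= mulr_ge0 // exprn_ge0 // invr_ge0.
- rewrite /homog_abs /geometric /=.
  apply: (@le_trans _ _ (t ^+ k * (D * S ^+ k))); last first.
    rewrite mulrCA -exprMn ler_wpM2l // [t * S]mulrC lerXn2r ?nnegrE ?invr_ge0 //.
    by rewrite mulr_ge0 // ltW.
  apply: (le_trans _ (ler_wpM2l (exprn_ge0 k (ltW t0)) (coef_le k))).
  rewrite mulr_sumr; apply: ler_sum => a /eqP ak; rewrite ler_wpM2r //.
  rewrite -[in leRHS]ak -prodrXr; apply: ler_prod => i _.
  by rewrite exprn_ge0 //= lerXn2r ?nnegrE // ltW.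
- by apply: is_cvg_geometric_series; rewrite gtr0_norm ?invf_lt1 ?ltr1n ?invr_gt0.
Qed.

(** * Gram-Schmidt *)

Section GramSchmidt.
Context (R : realType).

Definition col_norm m (a : 'cV[R]_m) : R := Num.sqrt (\sum_i a i 0 ^+ 2).

(** The projection onto [q] is removed from all remaining columns at once, so that the recursion
    drops one column and keeps the rows; hence rectangular matrices. The triangular factor is
    recovered afterwards as the transpose of the result times [A]. *)
Fixpoint gram_schmidt m n : 'M[R]_(m, n) -> 'M[R]_(m, n) :=
  if n is n'.+1 then fun A =>
    let q := (col_norm (lsubmx (A : 'M[R]_(m, 1 + n'))))^-1 *: lsubmx (A : 'M[R]_(m, 1 + n')) in
    row_mx q (gram_schmidt (rsubmx (A : 'M[R]_(m, 1 + n')) -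
                            q *m (q^T *m rsubmx (A : 'M[R]_(m, 1 + n')))))
  else id.

Lemma gram_schmidtS m n (a : 'cV[R]_m) (A : 'M[R]_(m, n)) :
  let q := (col_norm a)^-1 *: a in
  gram_schmidt (row_mx a A : 'M[R]_(m, 1 + n)) =
    row_mx q (gram_schmidt (A - q *m (q^T *m A))).
Proof. by rewrite /= row_mxKl row_mxKr. Qed.

Lemma trmx_mul_col m (a : 'cV[R]_m) : a^T *m a = (\sum_i a i 0 ^+ 2)%:M.
Proof.
apply/matrixP => i j; rewrite !ord1 !mxE eqxx mulr1n.
by apply: eq_bigr => k _; rewrite !mxE expr2.
Qed.

Lemma sum_sqr_gt0 m (a : 'cV[R]_m) : a != 0 -> 0 < \sum_i a i 0 ^+ 2.
Proof.
move=> a0; rewrite lt_def sumr_ge0 ?andbT => [|i _]; last exact: sqr_ge0.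
apply: contra_neq a0 => /eqP; rewrite psumr_eq0 => [/allP a0|i _]; last exact: sqr_ge0.
apply/colP => i; have := a0 i (mem_index_enum _); rewrite /= sqrf_eq0 => /eqP ->.
by rewrite mxE.
Qed.

Lemma col_normZ m t (q : 'cV[R]_m) : 0 < t -> q^T *m q = 1%:M -> col_norm (t *: q) = t.
Proof.
move=> t0; rewrite trmx_mul_col => /matrixP/(_ 0 0); rewrite !mxE mulr1n => q1.
rewrite /col_norm (eq_bigr (fun i => t ^+ 2 * q i 0 ^+ 2)) => [|i _]; last by rewrite mxE exprMn.
by rewrite -mulr_sumr q1 mulr1 sqrtr_sqr gtr0_norm.
Qed.

Lemma normalize_col m (a : 'cV[R]_m) : a != 0 ->
  let q := (col_norm a)^-1 *: a in
  [/\ 0 < col_norm a, a = col_norm a *: q & q^T *m q = 1%:M].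
Proof.
move=> /sum_sqr_gt0 a0 q; have n0 : 0 < col_norm a by rewrite sqrtr_gt0.
split=> //; first by rewrite scalerA mulfV ?gt_eqF // scale1r.
have sqE : col_norm a ^+ 2 = \sum_i a i 0 ^+ 2 by rewrite sqr_sqrtr // ltW.
rewrite /q -scalemxAr [(_ *: a)^T]linearZ /= -scalemxAl trmx_mul_col scalerA -expr2.
by rewrite -sqE exprVn scale_scalar_mx mulVf // expf_neq0 // gt_eqF.
Qed.

(** Dual form of the fact that orthonormalization stays in the column span. With [u] the transpose
    of the first unit column, it makes the later columns orthogonal to that one. *)
Lemma mul_gram_schmidt_eq0 p m n (u : 'M[R]_(p, m)) (A : 'M[R]_(m, n)) :
  u *m A = 0 -> u *m gram_schmidt A = 0.
Proof.
elim: n A => [A|n IH]; first by move=> _; apply/matrixP => i [].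
rewrite -[n.+1]add1n => A; rewrite -[A]hsubmxK; move: (lsubmx _) (rsubmx _) => a {}A.
rewrite gram_schmidtS !mul_mx_row -(row_mx0 _ p 1 n) => /eq_row_mx[ua uA].
have uq : u *m ((col_norm a)^-1 *: a) = 0 by rewrite -scalemxAr ua scaler0.
by rewrite uq IH // mulmxBr (mulmxA u) uq mul0mx uA subrr.
Qed.

Lemma pos_upper_block n (t : 'M[R]_1) (r : 'rV[R]_n) (T : 'M[R]_n) :
  pos_upper_trig_mxs R (1 + n) (block_mx t r 0 T) <->
  0 < t 0 0 /\ pos_upper_trig_mxs R n T.
Proof.
split=> [[up pos]|[t0 [up pos]]].
  split; first by have := pos (lshift n (0 : 'I_1)); rewrite block_mxEul.
  split=> [i j ji|i]; last by have := pos (rshift 1 i); rewrite block_mxEdr.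
  by rewrite -(up (rshift 1 i) (rshift 1 j)) ?block_mxEdr.
split=> [i j|i].
  case: (split_ordP (i : 'I_(1 + n))) => i' ->; case: (split_ordP (j : 'I_(1 + n))) => j' ->.
  - by rewrite !ord1.
  - by rewrite /= !ord1.
  - by rewrite block_mxEdl mxE.
  - by rewrite block_mxEdr => /up.
case: (split_ordP (i : 'I_(1 + n))) => i' ->; last by rewrite block_mxEdr.
by rewrite block_mxEul ord1.
Qed.

Lemma mul_inj_col_neq0 m n (a : 'cV[R]_m) (A : 'M[R]_(m, n)) :
  (forall v : 'cV_(1 + n), row_mx a A *m v = 0 -> v = 0) -> a != 0.
Proof.
move=> inj; apply/eqP => a0; have := inj (col_mx 1%:M 0).
rewrite mul_row_col a0 mul0mx mulmx0 addr0 => /(_ erefl)/(congr1 usubmx).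
by rewrite col_mxKu linear0 => /matrixP/(_ 0 0)/eqP; rewrite !mxE oner_eq0.
Qed.

(** A kernel vector of the deflated matrix extends to one of [row_mx a A]: the added coefficient of
    [a] subtracts the projection onto [q]. *)
Lemma mul_inj_deflate m n (a : 'cV[R]_m) (A : 'M[R]_(m, n)) :
    (forall v : 'cV_(1 + n), row_mx a A *m v = 0 -> v = 0) ->
  let q := (col_norm a)^-1 *: a in
  forall v : 'cV_n, (A - q *m (q^T *m A)) *m v = 0 -> v = 0.
Proof.
move=> inj q v; have [n0 aE _] := normalize_col (mul_inj_col_neq0 inj) => Bv.
have /inj : row_mx a A *m col_mx (- ((col_norm a)^-1 *: (q^T *m A *m v))) v = 0.
  rewrite mul_row_col mulmxN -scalemxAr [X in X *m _]aE -scalemxAl scalerA mulVf ?gt_eqF //.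
  by rewrite scale1r addrC -Bv mulmxBl !mulmxA.
by move/(congr1 dsubmx); rewrite col_mxKd linear0.
Qed.

(** Injectivity stands in for invertibility because it passes to the rectangular deflated matrices
    of the induction. The later columns [Q] are orthogonal to [q], so [Q^T *m A] equals [Q^T *m B],
    to which the induction hypothesis applies. *)
Lemma gram_schmidtP m n (A : 'M[R]_(m, n)) :
    (forall v : 'cV[R]_n, A *m v = 0 -> v = 0) ->
  (gram_schmidt A)^T *m gram_schmidt A = 1%:M /\
  pos_upper_trig_mxs R n ((gram_schmidt A)^T *m A).
Proof.
elim: n A => [A|n IH]; first by move=> _; split; [apply/matrixP => -[]|split=> -[]].
rewrite -[n.+1]add1n => A; rewrite -[A]hsubmxK; move: (lsubmx _) (rsubmx _) => a {}A inj.
have a0 := mul_inj_col_neq0 inj.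
have [n0 aE qq] := normalize_col a0.
rewrite gram_schmidtS; set q := _ *: a in aE qq *; set B := A - _.
have qB : q^T *m B = 0 by rewrite mulmxBr [q^T *m (q *m _)]mulmxA qq mul1mx subrr.
have [QQ [up pos]] := IH B (mul_inj_deflate inj).
set Q := gram_schmidt B in QQ up pos *.
have qQ : q^T *m Q = 0 by exact: mul_gram_schmidt_eq0.
have Qq : Q^T *m q = 0 by rewrite -[LHS]trmxK trmx_mul trmxK qQ trmx0.
have QA : Q^T *m A = Q^T *m B by rewrite mulmxBr (mulmxA Q^T) Qq mul0mx subr0.
rewrite tr_row_mx !mul_col_row; split.
  by rewrite qq qQ Qq QQ [RHS](@scalar_mx_block _ 1 n).
rewrite [Q^T *m a](_ : _ = 0); last by rewrite aE -scalemxAr Qq scaler0.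
rewrite QA; apply/pos_upper_block; split=> //.
by rewrite aE -scalemxAr qq !mxE mulr1n mulr1.
Qed.

Lemma pos_upper_dlsubmx n (T : 'M[R]_(1 + n)) :
  pos_upper_trig_mxs R (1 + n) T -> dlsubmx T = 0.
Proof.
by move=> [up _]; apply/matrixP => i j; rewrite !mxE up //= !ord1.
Qed.

(** The source of uniqueness. The first column of the product is a positive multiple of [q], so
    normalizing returns [q]; deflation then removes [q *m r] and leaves the product of the smaller
    factors. *)
Lemma gram_schmidt_mul m n (Q : 'M[R]_(m, n)) (T : 'M[R]_n) :
    Q^T *m Q = 1%:M -> pos_upper_trig_mxs R n T ->
  gram_schmidt (Q *m T) = Q.
Proof.
elim: n Q T => [Q T|n IH]; first by move=> _ _; apply/matrixP => i [].
rewrite -[n.+1]add1n => Q T QQ Tup; have T0 := pos_upper_dlsubmx Tup.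
move: QQ Tup; rewrite -[Q]hsubmxK -[T]submxK T0.
move: (lsubmx Q) (rsubmx Q) (ulsubmx T) (ursubmx T) (drsubmx T) => q {T0}{}Q t r {}T.
rewrite tr_row_mx mul_col_row [1%:M](@scalar_mx_block _ 1 n).
move=> /eq_block_mx[qq qQ _ QQ] /pos_upper_block[t0 Tup].
have tE : t = (t 0 0)%:M by rewrite [LHS]mx11_scalar.
rewrite mul_row_block !mulmx0 addr0 gram_schmidtS {1 2 3 4 5 6}tE mul_mx_scalar.
have -> : (col_norm (t 0 0 *: q))^-1 *: (t 0 0 *: q) = q.
  by rewrite col_normZ // scalerA mulVf ?gt_eqF // scale1r.
congr row_mx; rewrite -[RHS](IH _ T) //; congr gram_schmidt.
by rewrite mulmxDr !mulmxA qq mul1mx qQ mul0mx addr0 addrAC subrr add0r.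
Qed.

End GramSchmidt.

Lemma sum_pair (U W : nmodType) (I : Type) (r : seq I) (P : pred I) (F : I -> U * W) :
  \sum_(i <- r | P i) F i = (\sum_(i <- r | P i) (F i).1, \sum_(i <- r | P i) (F i).2).
Proof.
elim: r => [|i r IH]; first by rewrite !big_nil.
by rewrite !big_cons IH; case: ifP => // _; case: (F i).
Qed.

(** * Analyticity of matrix-valued maps, entry by entry *)

Section AnalyticMatrices.
Context (R : realType) (V : normedVectType R).
Implicit Types (x y : V).

Definition mx_ganalytic m n (A : V -> 'M[R]_(m, n)) x :=
  forall i j, ganalytic (fun y => A y i j) x.

Lemma mx_ganalytic_cst m n (A : 'M[R]_(m, n)) x : mx_ganalytic (fun=> A) x.
Proof. by move=> i j; exact: ganalytic_cst. Qed.

Lemma mx_ganalytic_near m n (A B : V -> 'M[R]_(m, n)) x :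
  (\forall y \near x, A y = B y) -> mx_ganalytic A x -> mx_ganalytic B x.
Proof.
move=> AB Ax i j; apply: ganalytic_near (Ax i j).
by apply: filterS AB => y ->.
Qed.

Lemma mx_ganalyticD m n (A B : V -> 'M[R]_(m, n)) x :
  mx_ganalytic A x -> mx_ganalytic B x -> mx_ganalytic (fun y => A y + B y) x.
Proof.
move=> Ax Bx i j; apply: ganalytic_near (ganalyticD (Ax i j) (Bx i j)).
by apply: nearW => y; rewrite mxE.
Qed.

Lemma mx_ganalyticB m n (A B : V -> 'M[R]_(m, n)) x :
  mx_ganalytic A x -> mx_ganalytic B x -> mx_ganalytic (fun y => A y - B y) x.
Proof.
move=> Ax Bx i j; apply: ganalytic_near (ganalyticB (Ax i j) (Bx i j)).
by apply: nearW => y; rewrite !mxE.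
Qed.

Lemma mx_ganalyticM m n p (A : V -> 'M[R]_(m, n)) (B : V -> 'M[R]_(n, p)) x :
  mx_ganalytic A x -> mx_ganalytic B x -> mx_ganalytic (fun y => A y *m B y) x.
Proof.
move=> Ax Bx i j.
apply: (@ganalytic_near _ _ (fun y => \sum_k A y i k * B y k j)).
  by apply: nearW => y; rewrite mxE.
by apply: ganalytic_sum => k _; apply: ganalyticM.
Qed.

Lemma mx_ganalytic_tr m n (A : V -> 'M[R]_(m, n)) x :
  mx_ganalytic A x -> mx_ganalytic (fun y => (A y)^T) x.
Proof.
by move=> Ax i j; apply: ganalytic_near (Ax j i); apply: nearW => y; rewrite mxE.
Qed.

Lemma mx_ganalyticZ m n (f : V -> R) (A : V -> 'M[R]_(m, n)) x :
  ganalytic f x -> mx_ganalytic A x -> mx_ganalytic (fun y => f y *: A y) x.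
Proof.
move=> fx Ax i j; apply: ganalytic_near (ganalyticM fx (Ax i j)).
by apply: nearW => y; rewrite mxE.
Qed.

Lemma mx_ganalytic_mxvec m n (A : V -> 'M[R]_(m, n)) x :
  mx_ganalytic A x -> mx_ganalytic (fun y => mxvec (A y)) x.
Proof.
move=> Ax i k; rewrite ord1; case/mxvec_indexP: k => i' j'.
by apply: ganalytic_near (Ax i' j'); apply: nearW => y; rewrite mxvecE.
Qed.

Lemma mx_ganalytic_if m n (P : 'I_m -> 'I_n -> bool) (A : V -> 'M[R]_(m, n)) x :
  mx_ganalytic A x -> mx_ganalytic (fun y => \matrix_(i, j) (if P i j then A y i j else 0)) x.
Proof.
move=> Ax i j.
apply: (@ganalytic_near _ _ (fun y => if P i j then A y i j else 0)).
  by apply: nearW => y; rewrite mxE.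
by case: (P i j) => //; exact: ganalytic_cst.
Qed.

(** The induction follows the recursion. Injectivity at the point [x] makes the first column nonzero
    there, which is what the square root and the inverse ask for, and it is inherited by the
    deflated matrix. *)
Lemma mx_ganalytic_gram_schmidt m n (A : V -> 'M[R]_(m, n)) x :
    (forall v : 'cV_n, A x *m v = 0 -> v = 0) -> mx_ganalytic A x ->
  mx_ganalytic (fun y => gram_schmidt (A y)) x.
Proof.
elim: n A => [A _ _ i []//|n IH].
rewrite -[n.+1]add1n => A inj Ax.
have ax : mx_ganalytic (fun y => lsubmx (A y)) x.
  by move=> i j; apply: ganalytic_near (Ax i (lshift n j)); apply: nearW => y; rewrite mxE.
have bx : mx_ganalytic (fun y => rsubmx (A y)) x.
  by move=> i j; apply: ganalytic_near (Ax i (rshift 1 j)); apply: nearW => y; rewrite mxE.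
pose q y := (col_norm (lsubmx (A y)))^-1 *: lsubmx (A y).
pose B y := rsubmx (A y) - q y *m ((q y)^T *m rsubmx (A y)).
have {}inj (v : 'cV_(1 + n)) : row_mx (lsubmx (A x)) (rsubmx (A x)) *m v = 0 -> v = 0.
  by rewrite hsubmxK; exact: inj.
have a0 := mul_inj_col_neq0 inj.
have [n0 aE qq] := normalize_col a0.
have nx : ganalytic (fun y => col_norm (lsubmx (A y))) x.
  apply: ganalytic_sqrt; first exact: sum_sqr_gt0.
  apply: ganalytic_sum => i _; rewrite /=.
  by apply: ganalyticM (ax i 0) (ax i 0).
have qx : mx_ganalytic q x.
  by apply: mx_ganalyticZ ax; apply: ganalyticV nx; rewrite gt_eqF.
have Bx : mx_ganalytic B x.
  apply: (mx_ganalyticB bx); apply: (mx_ganalyticM qx).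
  by apply: (mx_ganalyticM _ bx); exact: mx_ganalytic_tr.
have gsB := IH B (mul_inj_deflate inj) Bx.
apply: (@mx_ganalytic_near _ _ (fun y => row_mx (q y) (gram_schmidt (B y)))).
  by apply: nearW => y; rewrite -[in RHS](hsubmxK (A y)) gram_schmidtS.
move=> i j; case: (split_ordP j) => k ->.
  by apply: ganalytic_near (qx i k); apply: nearW => y; rewrite row_mxEl.
by apply: ganalytic_near (gsB i k); apply: nearW => y; rewrite row_mxEr.
Qed.

Lemma analytic_at_mx m n (A : V -> 'M[R]_(m, n)) x : mx_ganalytic A x -> analytic_at A x.
Proof.
move=> Ax; apply: (@analytic_at_lincomb _ _ _ ('I_m * 'I_n)%type
    (fun k y => A y k.1 k.2) (fun k => delta_mx k.1 k.2)).
  by move=> k; exact: Ax.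
by move=> y; rewrite [LHS]matrix_sum_delta pair_bigA.
Qed.

Lemma analytic_at_mx_pair m n p q (A : V -> 'M[R]_(m, n) * 'M[R]_(p, q)) x :
    mx_ganalytic (fun y => (A y).1) x -> mx_ganalytic (fun y => (A y).2) x ->
  analytic_at A x.
Proof.
move=> A1 A2; pose I := ('I_m * 'I_n + 'I_p * 'I_q)%type.
apply: (@analytic_at_lincomb _ _ _ I
    (fun k y => match k with inl k => (A y).1 k.1 k.2 | inr k => (A y).2 k.1 k.2 end)
    (fun k => match k with inl k => (delta_mx k.1 k.2, 0) | inr k => (0, delta_mx k.1 k.2) end)).
  by case=> k; [exact: A1|exact: A2].
move=> y; rewrite sum_pair !big_sumType /=.
rewrite [X in (_ + X, _)]big1 => [|k _]; last by rewrite scaler0.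
rewrite [X in (_, X + _)]big1 => [|k _]; last by rewrite scaler0.
rewrite addr0 add0r -(pair_bigA _ (fun i j => (A y).1 i j *: delta_mx i j)).
rewrite -(pair_bigA _ (fun i j => (A y).2 i j *: delta_mx i j)) /=.
by rewrite -!matrix_sum_delta; case: (A y).
Qed.

End AnalyticMatrices.

(** * The slice chart *)

Section QR.
Context (R : realType) (n : nat).
Local Notation M := 'M[R]_n.
Implicit Types (A B Q T X Y : M).

Definition qr_orth A : M := gram_schmidt A.
Definition qr_tri A : M := (gram_schmidt A)^T *m A.

Lemma qr_unit A : A \in unitmx ->
  [/\ orthogonal_mxs R n (qr_orth A), pos_upper_trig_mxs R n (qr_tri A) &
      qr_orth A *m qr_tri A = A].
Proof.
move=> Au; have [|QQ Tup] := @gram_schmidtP _ _ _ A.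
  by move=> v Av; rewrite -[v](mulKmx Au) Av mulmx0.
have QQ' := mulmx1C QQ.
by split=> //; rewrite /qr_orth /qr_tri mulmxA QQ' mul1mx.
Qed.

Lemma qr_orth_mul Q T : orthogonal_mxs R n Q -> pos_upper_trig_mxs R n T ->
  qr_orth (Q *m T) = Q.
Proof. by move=> [QQ _]; exact: gram_schmidt_mul. Qed.

Lemma qr_tri_mul Q T : orthogonal_mxs R n Q -> pos_upper_trig_mxs R n T ->
  qr_tri (Q *m T) = T.
Proof.
move=> Qo Tup; rewrite /qr_tri -/(qr_orth _) qr_orth_mul // mulmxA.
by case: Qo => -> _; rewrite mul1mx.
Qed.

Lemma orthogonal_unit Q : orthogonal_mxs R n Q -> Q \in unitmx.
Proof. by move=> [QQ _]; case: (mulmx1_unit QQ). Qed.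

Lemma pos_upper_unit T : pos_upper_trig_mxs R n T -> T \in unitmx.
Proof.
move=> [up pos]; rewrite unitmxE unitfE -det_tr det_trig.
  by apply/prodf_neq0 => i _; rewrite mxE gt_eqF.
by apply/is_trig_mxP => i j ij; rewrite mxE up.
Qed.

Lemma qr_mul_unit Q T : orthogonal_mxs R n Q -> pos_upper_trig_mxs R n T ->
  Q *m T \in unitmx.
Proof. by move=> Qo Tup; rewrite unitmx_mul orthogonal_unit // pos_upper_unit. Qed.

Lemma pos_upper1 : pos_upper_trig_mxs R n 1%:M.
Proof.
split=> [i j ji|i]; rewrite mxE ?eqxx ?ltr01 //.
by case: eqP => // ij; rewrite ij ltnn in ji.
Qed.

Definition upper_part Y : M := \matrix_(i, j) if (i <= j)%N then Y i j else 0.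
Definition lower_part Y : M := \matrix_(i, j) if (j < i)%N then Y i j else 0.

Lemma upper_lower_part Y : upper_part Y + lower_part Y = Y.
Proof. by apply/matrixP => i j; rewrite !mxE; case: leqP; rewrite ?addr0 ?add0r. Qed.

Lemma upper_partK T : upper_trig_mxs R n T -> upper_part T = T.
Proof. by move=> up; apply/matrixP => i j; rewrite mxE; case: leqP => // /up. Qed.

Lemma lower_part0 T : upper_trig_mxs R n T -> lower_part T = 0.
Proof. by move=> up; apply/matrixP => i j; rewrite !mxE; case: ifP => // /up. Qed.

Lemma upper_partD Y Y' : upper_part (Y + Y') = upper_part Y + upper_part Y'.
Proof. by apply/matrixP => i j; rewrite !mxE; case: ifP; rewrite ?addr0. Qed.

Lemma lower_partD Y Y' : lower_part (Y + Y') = lower_part Y + lower_part Y'.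
Proof. by apply/matrixP => i j; rewrite !mxE; case: ifP; rewrite ?addr0. Qed.

Lemma upper_part_lower Y : upper_part (lower_part Y) = 0.
Proof. by apply/matrixP => i j; rewrite !mxE; case: leqP. Qed.

Lemma lower_part_lower Y : lower_part (lower_part Y) = lower_part Y.
Proof. by apply/matrixP => i j; rewrite !mxE; case: (j < i)%N. Qed.

Lemma upper_part_upper Y : upper_trig_mxs R n (upper_part Y).
Proof. by move=> i j ji; rewrite mxE leqNgt ji. Qed.

Lemma upper_part_pos Y : (forall i, 0 < Y i i) -> pos_upper_trig_mxs R n (upper_part Y).
Proof.
by move=> Y0; split=> [|i]; [exact: upper_part_upper|rewrite mxE leqnn].
Qed.

Lemma upper_trigB T T' : upper_trig_mxs R n T -> upper_trig_mxs R n T' ->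
  upper_trig_mxs R n (T - T').
Proof. by move=> up up' i j ji; rewrite !mxE up // up' // subr0. Qed.

(* Straightens O(n) x R^+ to GL(n) x {0}. *)
Definition straighten (p : M * M) : M * M :=
  (qr_orth p.1 *m upper_part p.2, qr_tri p.1 - 1%:M + lower_part p.2).

(** For [(A, B)] in the image, the decomposition of [A] returns Q(X) and up(Y). As R(X) - I is upper
    triangular, the two parts of [B] separate: up(B + I) is R(X) and low(B) is low(Y). *)
Definition unstraighten (p : M * M) : M * M :=
  (qr_orth p.1 *m upper_part (p.2 + 1%:M), qr_tri p.1 + lower_part p.2).

Definition straighten_dom : set (M * M) :=
  [set p : M * M | p.1 \in unitmx /\ forall i, 0 < p.2 i i].

Definition straighten_img : set (M * M) :=
  [set p : M * M | p.1 \in unitmx /\ forall i, 0 < p.2 i i + 1].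

Lemma diag_lower Y i : lower_part Y i i = 0.
Proof. by rewrite mxE ltnn. Qed.

Lemma straighten_in p : straighten_dom p -> straighten_img (straighten p).
Proof.
case: p => X Y [/= Xu Y0]; have [Qo [Tup T0] _] := qr_unit Xu.
split=> [|i] /=; first by apply: qr_mul_unit => //; exact: upper_part_pos.
by rewrite mxE diag_lower addr0 !mxE eqxx subrK; have := T0 i; rewrite mxE.
Qed.

Lemma unstraighten_in p : straighten_img p -> straighten_dom (unstraighten p).
Proof.
case: p => A B [/= Au B0]; have [Qo [Tup T0] _] := qr_unit Au.
split=> [|i] /=.
  by apply: qr_mul_unit => //; apply: upper_part_pos => i; rewrite !mxE eqxx.
by rewrite mxE diag_lower addr0; exact: T0.
Qed.

Lemma straightenK p : straighten_dom p -> unstraighten (straighten p) = p.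
Proof.
case: p => X Y [/= Xu Y0]; have [Qo Tup XE] := qr_unit Xu.
have Yup := upper_part_pos Y0; rewrite /unstraighten /straighten /=.
rewrite qr_orth_mul // qr_tri_mul // addrAC subrK.
rewrite upper_partD upper_part_lower addr0 upper_partK; last by case: Tup.
rewrite XE lower_partD lower_part_lower lower_part0 ?add0r ?upper_lower_part //.
by apply: upper_trigB; [case: Tup|case: pos_upper1].
Qed.

Lemma unstraightenK p : straighten_img p -> straighten (unstraighten p) = p.
Proof.
case: p => A B [/= Au B0]; have [Qo Tup AE] := qr_unit Au.
have Bup : pos_upper_trig_mxs R n (upper_part (B + 1%:M)).
  by apply: upper_part_pos => i; rewrite !mxE eqxx.
rewrite /unstraighten /straighten /=.
rewrite qr_orth_mul // qr_tri_mul // upper_partD upper_part_lower addr0.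
rewrite upper_partK; last by case: Tup.
rewrite AE lower_partD lower_part_lower [lower_part (qr_tri A)]lower_part0; last by case: Tup.
rewrite add0r upper_partD [upper_part 1%:M]upper_partK; last by case: pos_upper1.
by rewrite addrK upper_lower_part.
Qed.

(** R(X) - I is upper triangular and low(Y) strictly lower, so their sum vanishes only if both do.
    By uniqueness applied to X = X I, the condition R(X) = I characterizes orthogonal X; the shift
    by I places the slice at 0. *)
Lemma straighten_slice p : straighten_dom p ->
  (orthogonal_mxs R n p.1 /\ pos_upper_trig_mxs R n p.2) <-> (straighten p).2 = 0.
Proof.
case: p => X Y [/= Xu Y0]; have [Qo Tup XE] := qr_unit Xu; split=> [[Xo Yup]|e].
  have X1 : qr_tri X = 1%:M by rewrite -[X]mulmx1 qr_tri_mul //; exact: pos_upper1.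
  by rewrite /straighten /= X1 subrr add0r lower_part0 //; case: Yup.
have up1 : upper_trig_mxs R n (qr_tri X - 1%:M).
  by apply: upper_trigB; [case: Tup|case: pos_upper1].
have L0 : lower_part Y = 0.
  have := congr1 lower_part e; rewrite lower_partD lower_part_lower lower_part0 //.
  by rewrite add0r => ->; apply/matrixP => i j; rewrite !mxE; case: ifP.
split; last by rewrite -[Y]upper_lower_part L0 addr0; exact: upper_part_pos.
move: e; rewrite L0 addr0 => /eqP; rewrite subr_eq0 => /eqP T1.
by rewrite -XE T1 mulmx1.
Qed.

End QR.

(** * Continuity and open conditions on matrices *)

Section Openness.
Context (R : realType) (n : nat).
Local Notation M := 'M[R]_n.

Lemma continuous_det : continuous (fun A : M => \det A).
Proof.
have cprod (s : 'S_n) : continuous (fun A : M => \prod_i A i (s i)).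
  apply: (@continuous_big R _ *%R 1 xpredT _ _ _ (fun i (A : M) => A i (s i))) => [|i _].
    exact: mul_continuous.
  exact: (@coord_continuous R n n i (s i)).
apply: (@continuous_sum _ _ R _ _ _
  (fun (s : 'S_n) (A : M) => (-1) ^+ s * \prod_i A i (s i))) => s _ A.
exact: cvgM (cvg_cst _) (cprod s A).
Qed.

Lemma near_unitmx (T : topologicalType) (f : T -> M) (x : T) :
  {for x, continuous f} -> f x \in unitmx -> \forall y \near x, f y \in unitmx.
Proof.
move=> cf; rewrite unitmxE unitfE => fx0.
have df : (fun y => \det (f y)) @ x --> \det (f x).
  by apply: continuous_comp cf _; exact: continuous_det.
have dn : \forall y \near x, \det (f y) != 0 by exact: cvgr_neq0 _ df fx0.
by apply: filterS dn => y; rewrite unitmxE unitfE.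
Qed.

(** The offset [a] is 0 for the domain of the straightening and 1 for its image. *)
Lemma near_diag_gt0 (T : topologicalType) (f : T -> M) (a : R) (x : T) :
    {for x, continuous f} -> (forall i, 0 < f x i i + a) ->
  \forall y \near x, forall i, 0 < f y i i + a.
Proof.
move=> cf fx0; apply: filter_forall => i.
have cii : (fun y => f y i i) @ x --> f x i i.
  exact: (continuous_comp cf (@coord_continuous R n n i i (f x))).
have ci : (fun y => f y i i + a) @ x --> f x i i + a by exact: cvgD cii (cvg_cst a).
exact: cvgr_gt _ ci _ (fx0 i).
Qed.

Lemma open_GL : open (GL_mxs R n).
Proof.
rewrite openE => A Au.
by apply: (@near_unitmx _ id A) => //; exact: cvg_id.
Qed.

Lemma continuous_entries (T : topologicalType) m p (f : T -> 'M[R]_(m, p)) :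
  (forall i j, continuous (fun x => f x i j)) -> continuous f.
Proof.
move=> cf x P [Q xQ QP].
have : \forall y \near x, forall i j, Q i j (f y i j).
  apply: filter_forall => i; apply: filter_forall => j.
  exact: cf i j x _ (xQ i j).
by apply: filterS => y; exact: QP.
Qed.

Lemma continuous_vec_mx m p : continuous (vec_mx : 'rV[R]_(m * p) -> 'M[R]_(m, p)).
Proof.
apply: continuous_entries => i j a.
have -> : (fun x : 'rV[R]_(m * p) => vec_mx x i j) = (fun x => x 0 (mxvec_index i j)).
  by apply/funext => x; rewrite mxE.
exact: coord_continuous.
Qed.

Lemma open_straighten_dom : open (@straighten_dom R n).
Proof.
rewrite openE => p [pu p0].
have c1 : {for p, continuous (fun q : M * M => q.1)} by exact: cvg_fst.
have c2 : {for p, continuous (fun q : M * M => q.2)} by exact: cvg_snd.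
have p0' : forall i, 0 < p.2 i i + 0 by move=> i; rewrite addr0.
apply: filterS2 (near_unitmx c1 pu) (near_diag_gt0 c2 p0') => q q1 q2.
by split=> // i; rewrite -[ltRHS]addr0.
Qed.

Lemma open_straighten_img :
  open [set z : 'rV[R]_(n * n) * 'rV[R]_(n * n) |
        straighten_img (vec_mx z.1 : M, vec_mx z.2 : M)].
Proof.
rewrite openE => p [/= pu p0].
have c1 : {for p, continuous (fun q : 'rV[R]_(n * n) * 'rV[R]_(n * n) => vec_mx q.1 : M)}.
  by apply: (@continuous_comp _ _ _ fst); [exact: cvg_fst|exact: continuous_vec_mx].
have c2 : {for p, continuous (fun q : 'rV[R]_(n * n) * 'rV[R]_(n * n) => vec_mx q.2 : M)}.
  by apply: (@continuous_comp _ _ _ snd); [exact: cvg_snd|exact: continuous_vec_mx].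
by apply: filterS2 (near_unitmx c1 pu) (near_diag_gt0 c2 p0) => q q1 q2; split.
Qed.

End Openness.

(** * Global charts of O(n) x R^+ and of GL(n), and the diffeomorphism *)

Section Charts.
Context (R : realType) (n : nat).
Local Notation M := 'M[R]_n.
Local Notation rV := 'rV[R]_(n * n).

Lemma mx_ganalytic_fst m p q r (x : 'M[R]_(m, p) * 'M[R]_(q, r)) :
  mx_ganalytic (fun y : 'M[R]_(m, p) * 'M[R]_(q, r) => y.1) x.
Proof. by move=> i j; apply: ganalytic_scalar => a u v; rewrite !mxE. Qed.

Lemma mx_ganalytic_snd m p q r (x : 'M[R]_(m, p) * 'M[R]_(q, r)) :
  mx_ganalytic (fun y : 'M[R]_(m, p) * 'M[R]_(q, r) => y.2) x.
Proof. by move=> i j; apply: ganalytic_scalar => a u v; rewrite !mxE. Qed.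

Lemma mx_ganalytic_id m p (x : 'M[R]_(m, p)) :
  mx_ganalytic (fun y : 'M[R]_(m, p) => y) x.
Proof. by move=> i j; apply: ganalytic_scalar => a u v; rewrite !mxE. Qed.

Lemma mx_ganalytic_vec_mx (V : normedVectType R) (f : V -> rV) x :
  mx_ganalytic f x -> mx_ganalytic (fun y => vec_mx (f y) : M) x.
Proof.
move=> fx i j; apply: ganalytic_near (fx 0 (mxvec_index i j)).
by apply: nearW => y; rewrite mxE.
Qed.

Lemma mx_ganalytic_qr (V : normedVectType R) (A : V -> M) x :
    A x \in unitmx -> mx_ganalytic A x ->
  mx_ganalytic (fun y => qr_orth (A y)) x /\ mx_ganalytic (fun y => qr_tri (A y)) x.
Proof.
move=> Au Ax; have Qx : mx_ganalytic (fun y => qr_orth (A y)) x.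
  apply: mx_ganalytic_gram_schmidt Ax => v Av.
  by rewrite -[v](mulKmx Au) Av mulmx0.
by split=> //; apply: mx_ganalyticM => //; exact: mx_ganalytic_tr.
Qed.

Definition orth_tri_map (p : M * M) : rV * rV :=
  (mxvec (straighten p).1, mxvec (straighten p).2).

Definition orth_tri_inv (z : rV * rV) : M * M := unstraighten (vec_mx z.1, vec_mx z.2).

Lemma orth_tri_mapK p : straighten_dom p -> orth_tri_inv (orth_tri_map p) = p.
Proof.
by move=> pD; rewrite /orth_tri_inv /orth_tri_map /= !mxvecK; exact: straightenK.
Qed.

Lemma orth_tri_img : orth_tri_map @` @straighten_dom R n =
  [set z : rV * rV | straighten_img (vec_mx z.1 : M, vec_mx z.2 : M)].
Proof.
apply/seteqP; split=> [_ [p /straighten_in pI <-]|z zI].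
  by rewrite /orth_tri_map /= !mxvecK.
exists (orth_tri_inv z); first exact: unstraighten_in zI.
rewrite /orth_tri_map /orth_tri_inv (unstraightenK zI) /= !vec_mxK.
by rewrite -surjective_pairing.
Qed.

Lemma orth_tri_map_analytic p : straighten_dom p -> analytic_at orth_tri_map p.
Proof.
move=> [pu p0]; have X := mx_ganalytic_fst p; have Y := mx_ganalytic_snd p.
have [Q T] := mx_ganalytic_qr pu X.
apply: analytic_at_mx_pair; apply: mx_ganalytic_mxvec; rewrite /straighten /=.
  by apply: mx_ganalyticM Q _; exact: mx_ganalytic_if.
apply: mx_ganalyticD; last exact: mx_ganalytic_if.
by apply: mx_ganalyticB T _; exact: mx_ganalytic_cst.
Qed.

Lemma orth_tri_inv_analytic z :
  (orth_tri_map @` @straighten_dom R n) z -> analytic_at orth_tri_inv z.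
Proof.
rewrite orth_tri_img => -[zu z0].
have A : mx_ganalytic (fun y : rV * rV => vec_mx y.1 : M) z.
  by apply: mx_ganalytic_vec_mx; exact: mx_ganalytic_fst.
have B : mx_ganalytic (fun y : rV * rV => vec_mx y.2 : M) z.
  by apply: mx_ganalytic_vec_mx; exact: mx_ganalytic_snd.
have [Q T] := mx_ganalytic_qr (A := fun y : rV * rV => vec_mx y.1) zu A.
apply: analytic_at_mx_pair; rewrite /orth_tri_inv /unstraighten /=.
  apply: mx_ganalyticM Q _; apply: mx_ganalytic_if; apply: mx_ganalyticD B _.
  exact: mx_ganalytic_cst.
by apply: mx_ganalyticD T _; exact: mx_ganalytic_if.
Qed.

Lemma orth_tri_slice :
  orth_tri_map @` ((orthogonal_mxs R n `*` pos_upper_trig_mxs R n) `&` @straighten_dom R n) =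
  orth_tri_map @` @straighten_dom R n `&` [set z | z.2 = 0].
Proof.
apply/seteqP; split=> [_ [p [pOT pD] <-]|_ [[p pD <-] e]].
  split; first by exists p.
  by rewrite /mkset -[LHS]/(mxvec (straighten p).2) (straighten_slice pD).1 // linear0.
exists p => //; split=> //; apply/(straighten_slice pD).
by rewrite -[LHS]mxvecK (e : mxvec (straighten p).2 = 0) linear0.
Qed.

Lemma orth_tri_img_open : open (orth_tri_map @` @straighten_dom R n).
Proof. by rewrite orth_tri_img; exact: open_straighten_img. Qed.

(** The dimension is n(n-1)/2 for O(n) plus n(n+1)/2 for R^+, that is n^2, which leaves codimension
    n^2 in the space of pairs. *)
Definition orth_tri_chart :
    slice_chart (n * n) (orthogonal_mxs R n `*` pos_upper_trig_mxs R n) :=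
  @SliceChart R _ (n * n) _ (n * n) _ orth_tri_map orth_tri_inv
    (@open_straighten_dom R n) orth_tri_img_open
    orth_tri_map_analytic orth_tri_inv_analytic orth_tri_mapK orth_tri_slice.

Definition GL_map (A : M) : rV * 'rV[R]_0 := (mxvec A, 0).
Definition GL_inv (z : rV * 'rV[R]_0) : M := vec_mx z.1.

Lemma GL_mapK A : GL_mxs R n A -> GL_inv (GL_map A) = A.
Proof. by move=> _; rewrite /GL_inv mxvecK. Qed.

Lemma GL_img : GL_map @` GL_mxs R n = [set z : rV * 'rV[R]_0 | GL_mxs R n (vec_mx z.1)].
Proof.
apply/seteqP; split=> [_ [A Au <-]|[a b] ab]; first by rewrite /= mxvecK.
exists (vec_mx a) => //; rewrite /GL_map vec_mxK; congr (_, _).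
by apply/rowP => -[].
Qed.

Lemma GL_img_open : open (GL_map @` GL_mxs R n).
Proof.
rewrite GL_img openE => z zu.
have c1 : {for z, continuous (fun q : rV * 'rV[R]_0 => vec_mx q.1 : M)}.
  by apply: (@continuous_comp _ _ _ fst); [exact: cvg_fst|exact: continuous_vec_mx].
exact: near_unitmx c1 zu.
Qed.

Lemma GL_map_analytic A : GL_mxs R n A -> analytic_at GL_map A.
Proof.
move=> _; apply: analytic_at_mx_pair; last exact: mx_ganalytic_cst.
by apply: mx_ganalytic_mxvec; exact: mx_ganalytic_id.
Qed.

Lemma GL_inv_analytic z : (GL_map @` GL_mxs R n) z -> analytic_at GL_inv z.
Proof.
move=> _; apply: analytic_at_mx; apply: mx_ganalytic_vec_mx; exact: mx_ganalytic_fst.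
Qed.

Lemma GL_slice : GL_map @` (GL_mxs R n `&` GL_mxs R n) =
  GL_map @` GL_mxs R n `&` [set z | z.2 = 0].
Proof.
by rewrite setIid; apply/seteqP; split=> [_ [A Au <-]|z [] //]; split=> //; exists A.
Qed.

Definition GL_chart : slice_chart (n * n) (GL_mxs R n) :=
  @SliceChart R _ (n * n) _ 0 _ GL_map GL_inv (@open_GL R n) GL_img_open
    GL_map_analytic GL_inv_analytic GL_mapK GL_slice.

Lemma qr_map_image :
  qr_map R n @` (orthogonal_mxs R n `*` pos_upper_trig_mxs R n) = GL_mxs R n.
Proof.
apply/seteqP; split=> [_ [p [p1 p2] <-]|A Au]; first exact: qr_mul_unit.
by have [Qo Tup AE] := qr_unit Au; exists (qr_orth A, qr_tri A).
Qed.

(** On the slice the inverse chart is the QR decomposition itself, hence the product map reads as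
    the identity there. *)
Lemma orth_tri_inv0 (z : rV) : vec_mx z \in @unitmx R n ->
  orth_tri_inv (z, 0) = (qr_orth (vec_mx z), qr_tri (vec_mx z)).
Proof.
move=> zu; rewrite /orth_tri_inv /unstraighten /= linear0 add0r.
have [up1 _] := pos_upper1 R n; rewrite upper_partK // mulmx1 lower_part0 ?addr0 //.
by move=> i j _; rewrite mxE.
Qed.

(** Local expressions are total functions known to be the identity only over invertible matrices;
    openness of that set makes this enough. *)
Lemma analytic_at_near_id (f : rV -> rV) z :
    (forall y, vec_mx y \in @unitmx R n -> f y = y) -> vec_mx z \in @unitmx R n ->
  analytic_at f z.
Proof.
move=> fE zu; apply: analytic_at_mx; apply: mx_ganalytic_near (mx_ganalytic_id z).
have cz : {for z, continuous (vec_mx : rV -> M)} by exact: continuous_vec_mx.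
by apply: filterS (near_unitmx cz zu) => y /fE.
Qed.

Lemma qr_map_diffeo :
  analytic_diffeo (orthogonal_mxs R n `*` pos_upper_trig_mxs R n) (GL_mxs R n) (qr_map R n).
Proof.
have OTdom p : (orthogonal_mxs R n `*` pos_upper_trig_mxs R n) p -> straighten_dom p.
  by case=> p1 [p2 p0]; split=> //; exact: orthogonal_unit.
have mapsto p : (orthogonal_mxs R n `*` pos_upper_trig_mxs R n) p -> GL_mxs R n (qr_map R n p).
  by case; exact: qr_mul_unit.
have inv p : (orthogonal_mxs R n `*` pos_upper_trig_mxs R n) p ->
    (qr_orth (qr_map R n p), qr_tri (qr_map R n p)) = p.
  by case: p => Q T [Qo Tup]; rewrite /qr_map /= qr_orth_mul // qr_tri_mul.
exists (n * n)%N, (n * n)%N; split.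
- by move=> p /OTdom pD; exists orth_tri_chart.
- by move=> A Au; exists GL_chart.
- split=> //.
  + by move=> p q /set_mem/inv {2}<- /set_mem/inv {2}<- ->.
  + by move=> A; rewrite -qr_map_image.
- split=> // p pOT; exists orth_tri_chart, GL_chart; split=> [|_ [q [qOT _] <-]|y].
  + exact: OTdom.
  + exact: mapsto.
  + rewrite [chart_map _ @` _]orth_tri_img => -[yu _].
    apply: analytic_at_near_id yu => z zu /=.
    rewrite orth_tri_inv0 // /qr_map /=; have [_ _ ->] := qr_unit zu.
    by rewrite vec_mxK.
- exists (fun A => (qr_orth A, qr_tri A)); split; first exact: inv.
  have mapsto' A : GL_mxs R n A ->
      (orthogonal_mxs R n `*` pos_upper_trig_mxs R n) (qr_orth A, qr_tri A).
    by move=> Au; have [] := qr_unit Au.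
  split=> // A Au; exists GL_chart, orth_tri_chart; split=> [//|_ [B [Bu _] <-]|y].
    exact/OTdom/mapsto'.
  rewrite [chart_map _ @` _]GL_img => yu.
  apply: analytic_at_near_id yu => z zu /=; rewrite /GL_inv /=.
  have [Qo Tup zE] := qr_unit zu; rewrite upper_partK; last by case: Tup.
  (* An orthogonal matrix is its own orthogonal factor, by uniqueness applied to its product with
     the identity. *)
  rewrite -[X in qr_orth X *m _]mulmx1 qr_orth_mul //; last exact: pos_upper1.
  by rewrite zE vec_mxK.
Qed.

End Charts.

(** * Properness *)

Section Properness.
Context (R : realType) (n : nat).
Local Notation M := 'M[R]_n.

Lemma continuous_mulmx (T : topologicalType) m p q (f : T -> 'M[R]_(m, p))
    (g : T -> 'M[R]_(p, q)) :
  continuous f -> continuous g -> continuous (fun x => f x *m g x).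
Proof.
move=> cf cg; apply: continuous_entries => i j.
have -> : (fun x => (f x *m g x) i j) = (fun x => \sum_k f x i k * g x k j).
  by apply/funext => x; rewrite mxE.
apply: (@continuous_sum _ _ R) => k _ x.
have cfk := continuous_comp (cf x) (@coord_continuous R m p i k (f x)).
have cgk := continuous_comp (cg x) (@coord_continuous R p q k j (g x)).
exact: cvgM cfk cgk.
Qed.

Lemma continuous_trmx m p : continuous (fun A : 'M[R]_(m, p) => A^T).
Proof.
apply: continuous_entries => i j.
have -> : (fun A : 'M[R]_(m, p) => A^T i j) = (fun A => A j i).
  by apply/funext => A; rewrite mxE.
exact: coord_continuous.
Qed.

Lemma compact_mx_cube m p (a : R) :
  compact [set A : 'M[R]_(m, p) | forall i j, `|A i j| <= a].
Proof.
have -> : [set A : 'M[R]_(m, p) | forall i j, `|A i j| <= a] =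
    vec_mx @` [set v : 'rV[R]_(m * p) | forall k, `[- a, a]%classic (v 0 k)].
  apply/seteqP; split=> [A Aa|_ [v va <-] i j].
    exists (mxvec A); last exact: mxvecK.
    by move=> k; case/mxvec_indexP: k => i j; rewrite mxvecE /= in_itv /= -ler_norml.
  by have := va (mxvec_index i j); rewrite mxE /= in_itv /= -ler_norml.
apply: continuous_compact.
  by apply: continuous_subspaceT; exact: continuous_vec_mx.
by apply: (@rV_compact _ _ (fun=> `[- a, a]%classic)) => _; exact: segment_compact.
Qed.

Lemma closed_orthogonal : closed (orthogonal_mxs R n).
Proof.
have cid : continuous (fun A : M => A) by move=> A; exact: cvg_id.
have -> : orthogonal_mxs R n =
    (fun A : M => A^T *m A) @^-1` [set 1%:M] `&` (fun A : M => A *m A^T) @^-1` [set 1%:M].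
  by [].
have c1 : closed [set 1%:M : M].
  by apply: accessible_closed_set1; apply: hausdorff_accessible; exact: norm_hausdorff.
apply: closedI; apply: closed_comp c1 => A _.
- exact: (continuous_mulmx (@continuous_trmx n n) cid).
- exact: (continuous_mulmx cid (@continuous_trmx n n)).
Qed.

Lemma orthogonal_entry_le1 (Q : M) i j : orthogonal_mxs R n Q -> `|Q i j| <= 1.
Proof.
move=> [/matrixP/(_ j j)]; rewrite !mxE eqxx mulr1n => QQ _.
rewrite -ler_sqr ?nnegrE // expr1n -normrX ger0_norm ?sqr_ge0 // -QQ.
rewrite (bigD1 i) //= mxE -expr2 lerDl sumr_ge0 // => k _.
by rewrite mxE -expr2 sqr_ge0.
Qed.

Lemma compact_orthogonal : compact (orthogonal_mxs R n).
Proof.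
apply: subclosed_compact closed_orthogonal (@compact_mx_cube n n 1) _.
by move=> Q Qo i j; exact: orthogonal_entry_le1.
Qed.

(* On orthogonal Q, the equation Q R = B means R = Q^T B, so the preimage of K
   is the continuous image of a closed subset of the compact set O(n) x K. *)
Lemma qr_map_proper (C : set M) : closed C ->
  proper_on (orthogonal_mxs R n `*` C) (qr_map R n).
Proof.
move=> Ccl K Kc.
pose f (p : M * M) : M * M := (p.1, p.1^T *m p.2).
have c1 : continuous (fun p : M * M => p.1) by move=> p; exact: cvg_fst.
have c2 : continuous (fun p : M * M => p.2) by move=> p; exact: cvg_snd.
have ct : continuous (fun p : M * M => p.1^T).
  by move=> p; apply: continuous_comp (c1 p) _; exact: continuous_trmx.
have cm := continuous_mulmx ct c2.
have cf : continuous f by move=> p; exact: (cvg_pair (c1 p) (cm p)).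
have -> : orthogonal_mxs R n `*` C `&` qr_map R n @^-1` K =
    f @` ((orthogonal_mxs R n `*` K) `&` (fun p => p.1^T *m p.2) @^-1` C).
  apply/seteqP; split=> [[Q T] [[Qo CT] KQT]|_ [[Q B] [[/= Qo KB] CQB] <-]].
    have QTT : Q^T *m (Q *m T) = T by rewrite mulmxA; case: Qo => -> _; rewrite mul1mx.
    by exists (Q, Q *m T); rewrite /f /= ?QTT //; split; rewrite //= QTT.
  by split=> //=; rewrite /qr_map /= mulmxA; case: Qo => _ ->; rewrite mul1mx.
apply: continuous_compact; first exact: continuous_subspaceT.
apply: compact_closedI; first exact: compact_setX compact_orthogonal Kc.
by apply: closed_comp Ccl => p _; exact: cm.
Qed.

End Properness.

(** * Existence of the decomposition for arbitrary square matrices *)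

Section Existence.
Context (R : realType).

Lemma orthogonal_mul n (P Q : 'M[R]_n) :
  orthogonal_mxs R n P -> orthogonal_mxs R n Q -> orthogonal_mxs R n (P *m Q).
Proof.
move=> [P1 P2] [Q1 Q2]; rewrite /orthogonal_mxs /= trmx_mul; split.
  by rewrite -mulmxA (mulmxA P^T) P1 mul1mx.
by rewrite -mulmxA (mulmxA Q) Q2 mul1mx.
Qed.

(* The Householder reflection exchanging two vectors of the same length. *)
Lemma householder n (a b : 'cV[R]_n) : a^T *m a = b^T *m b ->
  exists2 H : 'M[R]_n, orthogonal_mxs R n H & H *m a = b.
Proof.
move=> ab; have [->|anb] := eqVneq a b.
  by exists 1%:M; [split; rewrite trmx1 mulmx1|rewrite mul1mx].
pose w := a - b; have w0 : w != 0 by rewrite subr_eq0.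
pose s := \sum_i w i 0 ^+ 2; have s0 : 0 < s by exact: sum_sqr_gt0.
have ww : w^T *m w = s%:M by exact: trmx_mul_col.
pose c := 2 / s; pose u := w *m w^T; pose H : 'M[R]_n := 1%:M - c *: u.
have Ht : H^T = H by rewrite /H linearB /= [(_ *: u)^T]linearZ /= trmx1 trmx_mul trmxK.
have HH : H *m H = 1%:M.
  have uu : u *m u = s *: u by rewrite /u mulmxA -(mulmxA w) ww mul_mx_scalar -scalemxAl.
  have ccs : c * c * s = c + c by rewrite /c; field; rewrite gt_eqF.
  rewrite /H mulmxBl mul1mx mulmxBr mulmx1 -scalemxAl -scalemxAr uu !scalerA -mulrA.
  by rewrite mulrA ccs scalerDl
    [c *: u - _](_ : _ = - (c *: u)) ?opprK ?subrK // opprD addrA subrr add0r.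
exists H; first by split; rewrite Ht.
have ba : b^T *m a = a^T *m b.
  have -> : b^T *m a = (a^T *m b)^T by rewrite trmx_mul trmxK.
  by apply/matrixP => i j; rewrite !ord1 mxE.
(* Equal lengths of [a] and [b] give |w|^2 = 2 w^T a, so the reflection subtracts exactly [w] from
   [a]. *)
have wwE : w^T *m w = w^T *m a + w^T *m a.
  have wt : w^T = a^T - b^T by rewrite linearB.
  by rewrite {2}/w mulmxBr wt !mulmxBl -ab ba opprB.
have wa : w^T *m a = (s / 2)%:M.
  apply/matrixP => i j; rewrite !ord1.
  move: wwE; rewrite ww => /matrixP/(_ 0 0); rewrite !mxE eqxx !mulr1n => ->.
  by field.
rewrite /H mulmxBl mul1mx -scalemxAl -mulmxA wa mul_mx_scalar scalerA.
have -> : c * (s / 2) = 1 by rewrite /c; field; rewrite gt_eqF.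
by rewrite scale1r /w subKr.
Qed.

Lemma upper_trig_block n (t : 'M[R]_1) (r : 'rV[R]_n) (T : 'M[R]_n) :
  upper_trig_mxs R n T -> upper_trig_mxs R (1 + n) (block_mx t r 0 T).
Proof.
move=> up i j; case: (split_ordP i) => i' ->; case: (split_ordP j) => j' ->.
- by rewrite !ord1.
- by rewrite /= !ord1.
- by rewrite block_mxEdl mxE.
- by rewrite block_mxEdr => /up.
Qed.

(** A reflection [H] sends the first column to a multiple of the first basis vector, even when that
    column is zero. The lower right block of [H *m A] is decomposed by induction, and its orthogonal
    factor is bordered by 1. *)
Lemma qr_exists n (A : 'M[R]_n) : exists Q T : 'M[R]_n,
  [/\ orthogonal_mxs R n Q, upper_trig_mxs R n T & A = Q *m T].
Proof.
elim: n A => [A|n IH].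
  by exists 1%:M, A; split; [split; rewrite trmx1 mulmx1|case|rewrite mul1mx].
rewrite -[n.+1]add1n => A; pose a := lsubmx A.
pose b : 'cV[R]_(1 + n) := col_mx (col_norm a)%:M 0.
have [|H Ho Ha] := @householder _ a b.
  rewrite tr_col_mx mul_row_col trmx0 mul0mx addr0 tr_scalar_mx mul_scalar_mx.
  rewrite scale_scalar_mx -expr2 trmx_mul_col sqr_sqrtr // sumr_ge0 // => i _.
  exact: sqr_ge0.
pose C := H *m rsubmx A; have [Q [T [[Q1 Q2] Tup QT]]] := IH (dsubmx C).
exists (H^T *m block_mx 1%:M 0 0 Q), (block_mx (col_norm a)%:M (usubmx C) 0 T).
have HtO : orthogonal_mxs R (1 + n) H^T by case: Ho => H1 H2; split; rewrite trmxK.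
split; last 1 first.
- rewrite -mulmxA mulmx_block !mul1mx !mul0mx !mulmx0 !addr0 !add0r -QT.
  have -> : block_mx (col_norm a)%:M (usubmx C) 0 (dsubmx C) = H *m A.
    by rewrite block_mxEh vsubmxK -/b -Ha -mul_mx_row hsubmxK.
  by rewrite mulmxA; case: Ho => -> _; rewrite mul1mx.
- apply: orthogonal_mul => //; split.
    rewrite tr_block_mx mulmx_block !trmx0 trmx1 !mul0mx !mulmx0 !addr0 !add0r mul1mx Q1.
    by rewrite -(@scalar_mx_block _ 1 n).
  rewrite tr_block_mx mulmx_block !trmx0 trmx1 !mul0mx !mulmx0 !addr0 !add0r mul1mx Q2.
  by rewrite -(@scalar_mx_block _ 1 n).
- exact: upper_trig_block.
Qed.

End Existence.

Theorem theorem1 (R : realType) (n : nat) (n_gt0 : (0 < n)%N) :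
  [/\ (* (1) *)
      proper_on (orthogonal_mxs R n `*` closure (pos_upper_trig_mxs R n))
                (qr_map R n),
      (* (2) *)
      analytic_diffeo (orthogonal_mxs R n `*` pos_upper_trig_mxs R n)
        (qr_map R n @` (orthogonal_mxs R n `*` pos_upper_trig_mxs R n))
        (qr_map R n) /\
      qr_map R n @` (orthogonal_mxs R n `*` pos_upper_trig_mxs R n)
        = GL_mxs R n &
      (* (3) *)
      (forall A : 'M[R]_n, exists Q T : 'M[R]_n,
         [/\ orthogonal_mxs R n Q, upper_trig_mxs R n T & A = Q *m T]) /\
      (forall A : 'M[R]_n, A \in unitmx ->
         exists! QT : 'M[R]_n * 'M[R]_n,
           [/\ orthogonal_mxs R n QT.1, pos_upper_trig_mxs R n QT.2 &
               A = QT.1 *m QT.2])].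
Proof.
split.
- by apply: qr_map_proper; exact: closed_closure.
- by rewrite qr_map_image; split=> //; exact: qr_map_diffeo.
- split=> A; first exact: qr_exists.
  move=> Au; have [Qo Tup AE] := qr_unit Au.
  (* Uniqueness: the two maps read the factors of any admissible product back from the product. *)
  exists (qr_orth A, qr_tri A); split=> // -[Q T] [/= Qo' Tup' ->].
  by rewrite qr_orth_mul // qr_tri_mul.
Qed.
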